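(* Let $k\geqslant 3$ be an odd integer and $n\geqslant 1$ fixed. For $\mathbf a=(a_1,\ldots,a_n)\in\mathbb{N}^n$ let $\mathbb{Q}(\sqrt[k]{\mathbf a})=\mathbb{Q}(\sqrt[k]{a_1},\ldots,\sqrt[k]{a_n})$, where $\sqrt[k]{a_i}$ denotes the real $k$-th root. Let $G_n^k(H)$ be the number of distinct fields $\mathbb{Q}(\sqrt[k]{\mathbf a})$ with $\mathbf a\in\mathbb{N}^n\cap[1,H]^n$ and $[\mathbb{Q}(\sqrt[k]{\mathbf a}):\mathbb{Q}]=k^n$. Then, as $H\to\infty$, $$G_n^k(H)=\Big(\frac{1}{n!\,\zeta(k)^n}+O\Big(e^{-(1+o(1))\sqrt{(\log H)(\log\log H)/2}}\Big)\Big)H^n,$$ where $\zeta$ is the Riemann zeta function. *)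

(* Defs.v *)
From HB Require Import structures.
From mathcomp Require Import all_boot all_order all_algebra.
From mathcomp Require Import finmap.
From mathcomp Require Import all_classical all_reals all_analysis.

Set Implicit Arguments.
Unset Strict Implicit.
Unset Printing Implicit Defensive.

Import Order.TTheory GRing.Theory Num.Theory.
Import numFieldNormedType.Exports.

Local Open Scope classical_set_scope.
Local Open Scope ring_scope.

Section Definitions.
Context {R : realType}.

Definition subfield (K : set R) : Prop := divring_closed (mem K).

(* [Q(S)]: the prime field of [R] is contained in every subfield. *)
Definition adjoinQ (S : set R) : set R := smallest subfield S.

(* For [a > 0] this is the unique positive real [x] with [x ^+ k = a]. *)
Definition kroot (k a : nat) : R := a%:R `^ k%:R^-1.

Definition radical_field (k n : nat) (a : 'I_n -> nat) : set R :=
  adjoinQ (range (fun i => kroot k (a i))).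

Definition Q_free (d : nat) (b : 'I_d -> R) : Prop :=
  forall c : 'I_d -> rat,
    \sum_(i < d) ratr (c i) * b i = 0 -> forall i, c i = 0.

Definition Q_span (d : nat) (b : 'I_d -> R) : set R :=
  [set x | exists c : 'I_d -> rat, x = \sum_(i < d) ratr (c i) * b i].

(* [K : Q] = d *)
Definition has_degree (K : set R) (d : nat) : Prop :=
  exists b : 'I_d -> R, Q_free b /\ Q_span b = K.

(* The fields counted by G_n^k(H), as subfields of [R]. *)
Definition radical_fields (k n : nat) (H : R) : set (set R) :=
  [set K | exists a : 'I_n -> nat,
    [/\ forall i, (1 <= a i)%N /\ (a i)%:R <= H,
        has_degree (radical_field k a) (k ^ n)
      & K = radical_field k a]].

(* [fset_set] returns [fset0] on infinite sets, so [Gcount] below relies on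
   this. *)
Lemma finite_radical_fields (k n : nat) (H : R) :
  finite_set (radical_fields k n H).
Proof.
pose N := `|Num.ceil H|%N.
apply: (@sub_finite_set _ _
  ((fun a : {ffun 'I_n -> 'I_N.+1} => radical_field k (fun i => a i : nat))
     @` [set: {ffun 'I_n -> 'I_N.+1}])); last first.
  exact/finite_image/finite_finset.
move=> K [a [aH _ ->]].
have aN i : (a i < N.+1)%N.
  have [a1 aiH] := aH i.
  rewrite ltnS -(ler_nat R) (le_trans aiH)// (le_trans (ceil_ge H))//.
  by rewrite natr_absz ler_int ler_norm.
exists [ffun i => Ordinal (aN i)] => //=.
by congr radical_field; apply/funext => i; rewrite ffunE.
Qed.

Definition Gcount (k n : nat) (H : R) : nat :=
  #|` fset_set (radical_fields k n H)|.

(* The Riemann zeta function on the half-line s > 1. *)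
Definition zeta (s : R) : R :=
  limn (series (fun m : nat => m.+1%:R `^ (- s))).

End Definitions.

(* Main.v *)
(* Let [y] be close to [exp (sqrt (log H loglog H / 2))]. Call a tuple [a] of
   [k]-free integers in [1, H] good if every [a_i] has a prime factor larger
   than [y], and every prime larger than [y] divides at most one [a_i], and this
   one at most once. A good tuple generates a field of degree [k^n], and two
   good tuples generating the same field are permutations of each other: this is read
   off from the valuations at the large primes, once one knows that a positive
   real [k]-th root in [Q(a_1^(1/k), ..., a_n^(1/k))] is a rational multiple of a
   monomial in the [a_i^(1/k)]. The latter holds because the trace of a real
   number field kills every irrational positive radical in it. Hence [G] is the
   number of [k]-free tuples divided by [n!], up to the number of bad tuples,
   which is [O(H^n)] times the density of the [y]-smooth numbers plus [1 / y].
   Rankin's trick bounds the former, and the chosen [y] balances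
   the two terms. *)
Require Import Defs.
From HB Require Import structures.
From mathcomp Require Import all_boot all_order all_algebra.
From mathcomp Require Import fingroup perm finmap.
From mathcomp Require Import all_classical all_reals all_analysis.
From mathcomp Require Import ring lra zify.
Set Implicit Arguments.
Unset Strict Implicit.
Unset Printing Implicit Defensive.
Import Order.TTheory GRing.Theory Num.Theory.
Import numFieldNormedType.Exports.
Local Open Scope classical_set_scope.
Local Open Scope ring_scope.

(** * Traces of real radicals *)

(** The remainder theorem over a matrix ring: [X - M] divides [p(X) - p(M)]. Horner's step is [(p X
    + c) - (p(M) M + c) = (p - p(M)) X + p(M) (X - M)], where [p(M)] commutes with [X - M]. *)
Lemma horner_mx_factor (F : fieldType) n (M : 'M[F]_n.+1) (p : {poly F}) :
  exists Q : 'M[{poly F}]_n.+1,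
    p%:M - map_mx polyC (horner_mx M p) = char_poly_mx M * Q.
Proof.
elim/poly_ind: p => [|p c [Q IH]].
  exists 0; rewrite mulr0 (rmorph0 (horner_mx M)) raddf0 sub0r.
  by apply/matrixP=> i j; rewrite !mxE oppr0.
pose P := map_mx (@polyC F) (horner_mx M p).
have PM : P * char_poly_mx M = char_poly_mx M * P.
  rewrite /char_poly_mx mulrBl mulrBr; congr (_ - _).
    exact: scalar_mxC.
  rewrite -[LHS]/(_ *m _) -[RHS]/(_ *m _) -!map_mxM.
  by congr (map_mx _ _); apply: comm_horner_mx; exact: comm_mx_refl.
exists (Q * 'X%:M + P).
rewrite mulrDr mulrA -IH -PM.
have -> : horner_mx M (p * 'X + c%:P) = horner_mx M p * M + c%:M.
  by rewrite rmorphD rmorphM /= horner_mx_X horner_mx_C.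
rewrite map_mxD map_mxM map_scalar_mx /= raddfD /= scalar_mxM.
rewrite /char_poly_mx -/P mulrBl mulrBr -!mulmxE opprD.
by rewrite [RHS]addrA subrK addrACA subrr addr0.
Qed.

(** If [p(M) = 0], the factorization becomes [p I = (X - M) Q]; take determinants. *)
Lemma char_poly_dvd_exp (F : fieldType) n (M : 'M[F]_n.+1) (p : {poly F}) :
  horner_mx M p = 0 -> char_poly M %| p ^+ n.+1.
Proof.
move=> pM; have [Q] := horner_mx_factor M p.
rewrite pM (_ : map_mx _ 0 = 0); last by apply/matrixP=> i j; rewrite !mxE.
rewrite subr0 => /(congr1 determinant).
by rewrite det_scalar det_mulmx => ->; rewrite dvdp_mulr.
Qed.

Lemma prime_poly_coprimep (F : fieldType) (h p : {poly F}) : h != 0 ->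
    (forall f g, h %| f * g -> h %| f \/ h %| g) ->
  ~~ (h %| p) -> coprimep p h.
Proof.
move=> h0 hprime hp; have /dvdpP[q hq] := dvdp_gcdr p h.
have [hdq|hdg] := hprime q (gcdp p h) ltac:(by rewrite -hq); last first.
  by case/negP: hp; apply: dvdp_trans hdg (dvdp_gcdl _ _).
have q0 : q != 0 by apply: contra_neq h0 => q0; rewrite hq q0 mul0r.
have g0 : gcdp p h != 0 by apply: contra_neq h0 => g0; rewrite hq g0 mulr0.
move: (dvdp_leq q0 hdq); rewrite {1}hq size_mul // /coprimep => le.
by move: g0 q0; rewrite -!size_poly_eq0; lia.
Qed.

Lemma monic_dvd_prime_exp (F : fieldType) (h : {poly F}) : h \is monic ->
    (forall f g, h %| f * g -> h %| f \/ h %| g) ->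
  forall m p, p \is monic -> p %| h ^+ m -> exists e, p = h ^+ e.
Proof.
move=> hm hprime; elim=> [|m IH] p pm.
  rewrite expr0 dvdp1 => /size_poly1P [c c0 pc]; exists 0%N.
  by move: pm; rewrite pc expr0 monicE lead_coefC => /eqP ->.
move=> pdvd; have [hp|hnp] := boolP (h %| p).
  move: hp => /dvdpP [q pq]; move: pm pdvd; rewrite {}pq.
  rewrite (mulrC q) exprS monicMl // => qm; rewrite dvdp_mul2l ?monic_neq0//.
  by move=> /(IH _ qm) [e ->]; exists e.+1; rewrite exprS.
apply: (IH p pm); move: pdvd; rewrite exprS Gauss_dvdpr //.
exact: prime_poly_coprimep (monic_neq0 hm) hprime hnp.
Qed.

(* [M] is to be thought of as the matrix of the multiplication by [r]. Its
   characteristic polynomial is a power of the minimal polynomial [h] of [r], so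
   that [|h(0)|] is a power of [|det M| = r^(n+1)] and equals [r^m] with
   [m = deg h]; hence [h = X^m - r^m], and [m > 1] as [r] is irrational. *)
Lemma trace_irrational_radical (R : realFieldType) n (M : 'M[rat]_n.+1)
    (r : R) (k : nat) (q : rat) :
  (forall f : {poly rat}, (map_poly ratr f).[r] = 0 <-> horner_mx M f = 0) ->
  (0 < k)%N -> 0 < r -> r ^+ k = ratr q -> (forall c : rat, r != ratr c) ->
  \tr M = 0.
Proof.
move=> rM k0 r0 rk rirr; set h := mxminpoly M.
have hP f : h %| f <-> (map_poly ratr f).[r] = 0.
  by rewrite rM; split=> /mxminpoly_minP.
have hm : h \is monic := mxminpoly_monic M.
have h0 := monic_neq0 hm.
have hprime f g : h %| f * g -> h %| f \/ h %| g.
  rewrite !hP rmorphM hornerM => /eqP; rewrite mulf_eq0.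
  by case/orP=> /eqP; [left | right].
have hM : horner_mx M h = 0 by apply/mxminpoly_minP; rewrite dvdpp.
have [e pe] := monic_dvd_prime_exp hm hprime (char_poly_monic M)
  (char_poly_dvd_exp hM).
pose m := (size h).-1.
have sh : size h = m.+1 by rewrite prednK// lt0n size_poly_eq0.
have nme : (m * e)%N = n.+1.
  by rewrite /m -size_exp -pe size_char_poly.
have e0 : (0 < e)%N by case: (e) nme; rewrite ?muln0.
have Mk : M ^+ k = q%:M.
  have : horner_mx M ('X^k - q%:P) = 0.
    apply/rM; rewrite rmorphB /= map_polyXn map_polyC /=.
    by rewrite hornerD hornerN hornerXn hornerC rk subrr.
  rewrite rmorphB /= rmorphXn /= horner_mx_X horner_mx_C => /eqP.
  by rewrite subr_eq0 => /eqP.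
(* Both sides are nonnegative, so their powers of exponent [e * k] are compared, by way of
   [|h(0)|^e = |det M|] and [|det M|^k = |q|^(n+1)]. *)
have h0r : ratr `|h`_0| = r ^+ m.
  apply: (@pexpIrn _ (e * k)); rewrite ?nnegrE ?muln_gt0 ?e0 //.
  - by rewrite ler0q.
  - by rewrite exprn_ge0 // ltW.
  have hd : `|h`_0| ^+ e = `|\det M|.
    have := char_poly_det M; rewrite pe -horner_coef0 horner_exp horner_coef0.
    move=> /(congr1 Num.norm); rewrite normrX normrM normrX.
    by rewrite normrN normr1 expr1n mul1r.
  have dk : `|\det M| ^+ k = `|q| ^+ n.+1.
    have det_exp (A : 'M[rat]_n.+1) j : \det (A ^+ j) = \det A ^+ j.
      by elim: j => [|j IH]; rewrite ?expr0 ?det1 // !exprS det_mulmx IH.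
    by rewrite -!normrX -det_exp Mk det_scalar.
  rewrite exprM -rmorphXn /= hd -rmorphXn /= dk rmorphXn /= ratr_norm -rk.
  rewrite ger0_norm ?exprn_ge0 ?ltW// -!exprM -nme.
  by congr (_ ^+ _); lia.
have m1 : (1 < m)%N.
  move: h0r sh => /[swap]; case: m nme => [|[|m]] //= _ _.
  by rewrite expr1 => E; have := rirr `|h`_0|; rewrite E eqxx.
have hE : h = 'X^m - `|h`_0|%:P.
  have m0 : (0 < m)%N by lia.
  have : h %| 'X^m - `|h`_0|%:P.
    apply/hP; rewrite rmorphB /= map_polyXn map_polyC /=.
    by rewrite hornerD hornerN hornerXn hornerC h0r subrr.
  move=> hd; apply/eqP; rewrite -eqp_monic ?monicXnsubC // -dvdp_size_eqp//.
  by rewrite size_XnsubC // sh.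
have := @char_poly_trace _ _ M isT; rewrite /= pe hE.
(* The characteristic polynomial is a polynomial in [X^m], and [m > 1] divides its degree [n + 1],
   hence not [n]: the coefficient of [X^n], which is [- \tr M], vanishes. *)
have -> : ('X^m - `|h`_0|%:P) ^+ e = (('X - `|h`_0|%:P) ^+ e) \Po 'X^m.
  by rewrite rmorphXn /= rmorphB /= comp_polyX comp_polyC.
rewrite coef_comp_poly_Xn; last lia.
case: ifP => [mn|_].
  by exfalso; have := dvdn_addr 1 mn; rewrite addn1 -nme dvdn_mulr // dvdn1; lia.
by move/eqP; rewrite eq_sym oppr_eq0 => /eqP.
Qed.

(** * Rational spans and multiplication by a real number *)

Lemma Q_span0 (R : realType) d (b : 'I_d -> R) : Q_span b 0.
Proof. by exists (fun=> 0); rewrite big1// => i _; rewrite rmorph0 mul0r. Qed.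

Lemma Q_spanD (R : realType) d (b : 'I_d -> R) x y :
  Q_span b x -> Q_span b y -> Q_span b (x + y).
Proof.
move=> [c ->] [e ->]; exists (fun i => c i + e i); rewrite -big_split /=.
by apply: eq_bigr => i _; rewrite rmorphD mulrDl.
Qed.

Lemma Q_spanZ (R : realType) d (b : 'I_d -> R) q x :
  Q_span b x -> Q_span b (ratr q * x).
Proof.
move=> [c ->]; exists (fun i => q * c i); rewrite mulr_sumr.
by apply: eq_bigr => i _; rewrite rmorphM mulrA.
Qed.

Lemma Q_span_sum (R : realType) d (b : 'I_d -> R) I (s : seq I) (F : I -> R) :
  (forall i, Q_span b (F i)) -> Q_span b (\sum_(i <- s) F i).
Proof.
move=> bF; elim/big_ind: _ => //; [exact: Q_span0 | move=> x y; exact: Q_spanD].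
Qed.

Lemma Q_span_gen (R : realType) d (b : 'I_d -> R) i : Q_span b (b i).
Proof.
exists (fun j => (j == i)%:R); rewrite (bigD1 i)//= eqxx rmorph1 mul1r.
by rewrite big1 ?addr0// => j /negPf ->; rewrite rmorph0 mul0r.
Qed.

Lemma Q_span_sub (R : realType) d e (b : 'I_d -> R) (c : 'I_e -> R) :
  (forall i, Q_span c (b i)) -> Q_span b `<=` Q_span c.
Proof. by move=> bc x [q ->]; apply: Q_span_sum => i; exact: Q_spanZ. Qed.

(** Dependent vectors are dropped one at a time. Traces require a basis before anything is known
    about the independence of the monomials. *)
Lemma Q_span_basis (R : realType) d (b : 'I_d -> R) :
  exists N (c : 'I_N -> R), Q_free c /\ Q_span c = Q_span b.
Proof.
elim: d b => [|d IH] b; first by exists 0%N, b; split=> // c _ [].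
have [bf|/existsNP[c /not_implyP[c0 /existsNP[j /eqP cj]]]] := pselect (Q_free b).
  by exists d.+1, b.
have [N [e [ef eE]]] := IH (b \o lift j) => {IH}.
suff bE : Q_span (b \o lift j) = Q_span b by exists N, e; rewrite eE.
apply/seteqP; split; apply: Q_span_sub => i; first exact: Q_span_gen.
case: (unliftP j i) => [i' ->|->]; first exact: (Q_span_gen (b \o lift j)).
exists (fun i' => - (c j)^-1 * c (lift j i')) => /=.
move: c0; rewrite (bigD1_ord j)//= => /eqP; rewrite addr_eq0 => /eqP cb.
under eq_bigr do rewrite rmorphM -mulrA.
rewrite -mulr_sumr rmorphN /= mulNr -mulrN -cb mulrA -rmorphM mulVf//.
by rewrite rmorph1 mul1r.
Qed.

Lemma mult_matrix (R : realType) N (b : 'I_N -> R) x :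
    (forall i, Q_span b (x * b i)) ->
  exists M : 'M[rat]_N, x *: (\col_i b i) = map_mx ratr M *m \col_i b i.
Proof.
move=> /choice[c xb]; exists (\matrix_(i, j) c i j); apply/colP => i.
by rewrite !mxE xb; apply: eq_bigr => j _; rewrite !mxE.
Qed.

Lemma Q_free_mx (R : realType) N (b : 'I_N -> R) : Q_free b ->
  forall m (A : 'M[rat]_(m, N)), map_mx ratr A *m (\col_i b i) = 0 -> A = 0.
Proof.
move=> bf m A A0; apply/matrixP => i j; rewrite mxE.
apply: (bf (A i)) => /=; move/colP/(_ i): A0; rewrite !mxE => A0; rewrite -[RHS]A0.
by apply: eq_bigr => l _; rewrite !mxE.
Qed.

Lemma horner_mult_matrix (R : realType) n (B : 'cV[R]_n.+1) (x : R)
    (M : 'M[rat]_n.+1) (f : {poly rat}) :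
  x *: B = map_mx ratr M *m B ->
  (map_poly ratr f).[x] *: B = map_mx ratr (horner_mx M f) *m B.
Proof.
move=> xM; elim/poly_ind: f => [|f c IH].
  by rewrite !raddf0 horner0 scale0r mul0mx.
have -> : horner_mx M (f * 'X + c%:P) = horner_mx M f *m M + c%:M.
  by rewrite rmorphD rmorphM /= horner_mx_X horner_mx_C.
have -> : (map_poly ratr (f * 'X + c%:P)).[x] = (map_poly ratr f).[x] * x + ratr c.
  by rewrite rmorphD rmorphM /= map_polyX map_polyC hornerMXaddC.
rewrite map_mxD map_mxM map_scalar_mx mulmxDl -mulmxA -xM -scalemxAr -IH.
by rewrite mul_scalar_mx scalerA scalerDl mulrC.
Qed.

(** For [x] in the span, [t x] is the trace of the multiplication by [x] on this ring of finite
    dimension over the rationals; [t 1] is the dimension. *)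
Lemma radical_trace (R : realType) N (b : 'I_N -> R) (k : nat) :
    Q_free b -> Q_span b 1 ->
    (forall x y, Q_span b x -> Q_span b y -> Q_span b (x * y)) -> (0 < k)%N ->
  exists t : R -> rat,
    [/\ forall (I : finType) (c : I -> rat) (x : I -> R),
          (forall i, Q_span b (x i)) ->
          t (\sum_i ratr (c i) * x i) = \sum_i c i * t (x i),
        t 1 != 0 &
        forall x, Q_span b x -> 0 < x -> (exists q, x ^+ k = ratr q) ->
          (forall c, x != ratr c) -> t x = 0].
Proof.
move=> bf b1 bM k0; case: N => [|n] in b bf b1 bM *.
  by case: b1 => c; rewrite big_ord0 => /eqP; rewrite oner_eq0.
set B := \col_i b i.
have /choice[M MP] x : exists M : 'M[rat]_n.+1,
    Q_span b x -> x *: B = map_mx ratr M *m B.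
  have [bx|nbx] := pselect (Q_span b x); last by exists 0.
  have [//|M xM] := @mult_matrix _ _ b x; last by exists M.
  by move=> i; apply: bM => //; exact: Q_span_gen.
have Muniq A A' : map_mx (ratr : rat -> R) A *m B = map_mx ratr A' *m B -> A = A'.
  move=> AA; apply/eqP; rewrite -subr_eq0; apply/eqP/(Q_free_mx bf).
  by rewrite map_mxB mulmxBl AA subrr.
have B0 : B != 0.
  apply/eqP => B0; case: b1 => c /eqP; rewrite big1 ?oner_eq0// => i _.
  by move/colP/(_ i): B0; rewrite !mxE => ->; rewrite mulr0.
exists (fun x => \tr (M x)); split.
- move=> I c x bx; rewrite (_ : M _ = \sum_i c i *: M (x i)).
    by rewrite raddf_sum; apply: eq_bigr => i _; rewrite /= mxtraceZ.
  apply: Muniq; rewrite -MP; last by apply: Q_span_sum => i; exact: Q_spanZ.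
  rewrite raddf_sum /= mulmx_suml scaler_suml; apply: eq_bigr => i _.
  by rewrite map_mxZ -scalemxAl -MP// scalerA.
- rewrite (_ : M 1 = 1%:M) ?mxtrace1 ?pnatr_eq0//; apply: Muniq.
  by rewrite -MP// scale1r map_mx1 mul1mx.
- move=> x bx x0 [q xq] xirr; apply: (trace_irrational_radical _ k0 x0 xq xirr).
  move=> f; have H := horner_mult_matrix f (MP _ bx); split=> [f0|f0].
    by apply: Muniq; rewrite -H f0 scale0r map_mx0 mul0mx.
  move: H; rewrite f0 map_mx0 mul0mx => /eqP; rewrite scaler_eq0 (negPf B0) orbF.
  by move/eqP.
Qed.

(** Multiplication by [x <> 0] is injective, so its matrix [M] is invertible; if [u] is the
    coordinate row of 1, that of the inverse of [x] is [u M^-1]. *)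
Lemma Q_span_inv (R : realType) N (b : 'I_N -> R) : Q_span b 1 ->
    (forall x y, Q_span b x -> Q_span b y -> Q_span b (x * y)) ->
  forall x, Q_span b x -> Q_span b x^-1.
Proof.
have [n [c [cf <-]]] := Q_span_basis b => c1 cM x cx.
have [->|x0] := eqVneq x 0; first by rewrite invr0; exact: Q_span0.
have [|M xM] := @mult_matrix _ _ c x.
  by move=> i; apply: cM => //; exact: Q_span_gen.
have Mu : M \in unitmx.
  rewrite unitmxE unitfE; apply/det0P => -[v v0 vM]; case/eqP: v0.
  apply: (Q_free_mx cf); apply: (scalerI x0); rewrite scaler0 scalemxAr xM.
  by rewrite mulmxA -map_mxM vM map_mx0 mul0mx.
have [u u1] := c1; pose y := (\row_i u i) *m invmx M.
exists (y 0); apply: (mulfI x0); rewrite mulfV// u1 mulr_sumr.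
transitivity ((map_mx ratr y *m (x *: \col_i c i)) 0 0).
  rewrite xM mulmxA -map_mxM /y mulmxKV// !mxE.
  by apply: eq_bigr => i _; rewrite !mxE.
by rewrite mxE; apply: eq_bigr => i _; rewrite !mxE mulrCA.
Qed.

(** * Fields generated by real radicals *)

Lemma kroot_gt0 (R : realType) k a : (0 < a)%N -> 0 < kroot k a :> R.
Proof. by move=> a0; rewrite powR_gt0// ltr0n. Qed.

Lemma kroot_expn (R : realType) k a : (0 < k)%N -> kroot k a ^+ k = a%:R :> R.
Proof.
by move=> k0; rewrite -powR_mulrn ?powR_ge0// -powRrM mulVf ?powRr1// pnatr_eq0 -lt0n.
Qed.

Lemma krootM (R : realType) k a b : kroot k (a * b) = kroot k a * kroot k b :> R.
Proof. by rewrite /kroot natrM powRM. Qed.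

Lemma kroot1 (R : realType) k : kroot k 1 = 1 :> R.
Proof. by rewrite /kroot powR1. Qed.

Lemma krootX (R : realType) k a m : kroot k (a ^ m) = kroot k a ^+ m :> R.
Proof. by elim: m => [|m IH]; rewrite ?kroot1// expnS krootM IH exprS. Qed.

Lemma kroot_prod (R : realType) k (I : finType) (F : I -> nat) :
  kroot k (\prod_i F i) = \prod_i kroot k (F i) :> R.
Proof. by apply: big_morph; [exact: krootM | exact: kroot1]. Qed.

Lemma krootK (R : realType) k d : (0 < k)%N -> kroot k (d ^ k) = d%:R :> R.
Proof. by move=> k0; rewrite krootX kroot_expn. Qed.

(** With [q = u / v], taking [k]-th powers gives [b v^k = u^k c]; the valuations are then compared
    modulo [k]. *)
Lemma kroot_ratio_logn (R : realType) k b c q : (0 < k)%N -> (0 < b)%N ->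
    (0 < c)%N -> kroot k b = ratr q * kroot k c :> R ->
  forall p, logn p b = logn p c %[mod k].
Proof.
move=> k0 b0 c0 bc p.
have q0 : 0 < q.
  rewrite -(ltr0q R); have := kroot_gt0 R k b0.
  by rewrite bc pmulr_lgt0// kroot_gt0.
have [u [v [u0 v0 qE]]] : exists u v : nat,
    [/\ (0 < u)%N, (0 < v)%N & q = u%:R / v%:R].
  exists `|numq q|%N, `|denq q|%N; split.
  - by rewrite absz_gt0 gt_eqF// numq_gt0.
  - by rewrite absz_gt0 denq_eq0.
  - by rewrite !pmulrn !gez0_abs ?divq_num_den// ltW// ?numq_gt0.
have qR : ratr q = u%:R / v%:R :> R by rewrite qE fmorph_div /= !ratr_nat.
have : (b * v ^ k = u ^ k * c)%N.
  apply/eqP; rewrite -(eqr_nat R) !natrM !natrX -(kroot_expn R b k0).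
  rewrite -(kroot_expn R c k0) -!exprMn bc qR.
  by apply/eqP; congr (_ ^+ _); field; rewrite pnatr_eq0 -lt0n.
move=> /(congr1 (logn p)); rewrite !lognM ?expn_gt0 ?u0 ?v0//.
rewrite !lognX ![(k * _)%N]mulnC addnC => /(congr1 (modn^~ k)).
by rewrite !modnMDl.
Qed.

Section Subfields.
Variables (R : realType) (K : set R).
Hypothesis Kf : subfield K.

Lemma subfield1 : K 1.
Proof. by have [/[!inE]] := Kf. Qed.

Lemma subfieldB x y : K x -> K y -> K (x - y).
Proof. by move=> Kx Ky; have [_ /(_ x y) + _] := Kf; rewrite !inE; apply. Qed.

Lemma subfieldV x : K x -> K x^-1.
Proof.
move=> Kx; have [_ _ /(_ 1 x)] := Kf; rewrite !inE mul1r; apply => //.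
exact: subfield1.
Qed.

Lemma subfieldM x y : K x -> K y -> K (x * y).
Proof.
move=> Kx Ky; have [_ _ /(_ x y^-1)] := Kf; rewrite !inE invrK; apply => //.
exact: subfieldV.
Qed.

Lemma subfieldD x y : K x -> K y -> K (x + y).
Proof.
move=> Kx Ky; rewrite -(opprK y) -(add0r (- y)); apply: subfieldB => //.
by apply: subfieldB => //; rewrite -(subrr 1); apply: subfieldB; exact: subfield1.
Qed.

Lemma subfield_nat m : K m%:R.
Proof.
elim: m => [|m IH]; last by rewrite -natr1; exact: subfieldD subfield1.
by rewrite mulr0n -(subrr 1); apply: subfieldB; exact: subfield1.
Qed.

Lemma subfield_ratr q : K (ratr q).
Proof.
have Kz (z : int) : K z%:~R.
  case: z => m; first exact: subfield_nat.
  rewrite NegzE rmorphN -sub0r.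
  by apply: subfieldB; [exact: (subfield_nat 0) | exact: (subfield_nat m.+1)].
by rewrite /ratr; apply: subfieldM => //; exact: subfieldV.
Qed.

Lemma subfieldX x m : K x -> K (x ^+ m).
Proof.
move=> Kx; elim: m => [|m IH]; first exact: subfield1.
by rewrite exprS; exact: subfieldM.
Qed.

Lemma subfield_prod (I : finType) (F : I -> R) :
  (forall i, K (F i)) -> K (\prod_i F i).
Proof. by move=> KF; elim/big_ind: _ => //; [exact: subfield1 | exact: subfieldM]. Qed.

Lemma subfield_sum (I : finType) (F : I -> R) :
  (forall i, K (F i)) -> K (\sum_i F i).
Proof. by move=> KF; elim/big_ind: _ => //; [exact: (subfield_nat 0) | exact: subfieldD]. Qed.

End Subfields.

Lemma sub_adjoinQ (R : realType) (S K : set R) :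
  subfield K -> S `<=` K -> adjoinQ S `<=` K.
Proof. by move=> Kf SK x; apply. Qed.

Lemma radical_field_sub (R : realType) (k n : nat) (a : 'I_n -> nat) (K : set R) :
  subfield K -> (forall i, K (kroot k (a i))) -> radical_field k a `<=` K.
Proof. by move=> Kf aK; apply: sub_adjoinQ => // x [i _ <-]. Qed.

Lemma radical_field_gen (R : realType) (k n : nat) (a : 'I_n -> nat) i :
  radical_field k a (kroot k (a i) : R).
Proof. by move=> K [_ aK]; apply: aK; exists i. Qed.

Lemma subfield_radical_field (R : realType) (k n : nat) (a : 'I_n -> nat) :
  subfield (radical_field k a : set R).
Proof.
split; first by rewrite inE => K [Kf _]; exact: subfield1.
- move=> x y; rewrite !inE => Kx Ky K KP.
  by apply: (subfieldB KP.1); [exact: Kx | exact: Ky].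
- move=> x y; rewrite !inE => Kx Ky K KP; apply: (subfieldM KP.1); first exact: Kx.
  by apply: (subfieldV KP.1); exact: Ky.
Qed.

Lemma radical_field_powfree (R : realType) (k n : nat) (a d f : 'I_n -> nat) :
    (0 < k)%N -> (forall i, 0 < d i)%N -> (forall i, a i = d i ^ k * f i)%N ->
  radical_field k a = radical_field k f :> set R.
Proof.
move=> k0 d0 af; have aE i : kroot k (a i) = (d i)%:R * kroot k (f i) :> R.
  by rewrite af krootM krootK.
apply/seteqP; split; apply: radical_field_sub => [|i].
- exact: subfield_radical_field.
- rewrite aE; apply: (subfieldM (@subfield_radical_field _ _ _ _)).
    exact: (subfield_nat (@subfield_radical_field _ _ _ _)).
  exact: radical_field_gen.
- exact: subfield_radical_field.
- rewrite (_ : kroot _ _ = (d i)%:R^-1 * kroot k (a i)); last first.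
    by rewrite aE mulKf// pnatr_eq0 -lt0n.
  apply: (subfieldM (@subfield_radical_field _ _ _ _)).
    apply: (subfieldV (@subfield_radical_field _ _ _ _)).
    exact: (subfield_nat (@subfield_radical_field _ _ _ _)).
  exact: radical_field_gen.
Qed.

(** * Monomials in the radicals, and the degree *)

Definition monomial n (a e : 'I_n -> nat) : nat := (\prod_i a i ^ e i)%N.

(** The [k ^ n] exponent vectors with entries below [k] are numbered by ordinals, because [Q_span]
    and [has_degree] take families indexed by ordinals. *)
Definition monomials (R : realType) (k n : nat) (a : 'I_n -> nat)
    (j : 'I_#|{ffun 'I_n -> 'I_k}|) : R :=
  kroot k (monomial a (fun i => enum_val j i)).

Lemma monomial_gt0 n (a e : 'I_n -> nat) : (forall i, 0 < a i)%N -> (0 < monomial a e)%N.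
Proof. by move=> a0; apply: prodn_gt0 => i; rewrite expn_gt0 a0. Qed.

Lemma monomialM n (a e f : 'I_n -> nat) :
  (monomial a e * monomial a f = monomial a (fun i => e i + f i))%N.
Proof. by rewrite -big_split; apply: eq_bigr => i _; rewrite expnD. Qed.

(** Each exponent is reduced modulo [k]; the quotients produce the [k]-th power of an integer, whose
    root is rational. *)
Lemma monomial_span (R : realType) k n (a e : 'I_n -> nat) : (0 < k)%N ->
  Q_span (@monomials R k n a) (kroot k (monomial a e)).
Proof.
move=> k0; pose f : {ffun 'I_n -> 'I_k} := [ffun i => Ordinal (ltn_pmod (e i) k0)].
have -> : monomial a e =
    (monomial a (fun i => e i %/ k) ^ k * monomial a (fun i => f i))%N.
  rewrite /monomial (big_morph _ (fun x y => expnMn x y k) (exp1n k)) -big_split.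
  apply: eq_bigr => i _.
  by rewrite ffunE /= -expnM -expnD -divn_eq.
rewrite krootM krootK// -(ratr_nat R); apply: Q_spanZ.
by have := Q_span_gen (@monomials R k n a) (enum_rank f); rewrite /monomials enum_rankK.
Qed.

Lemma monomials_span1 (R : realType) k n (a : 'I_n -> nat) : (0 < k)%N ->
  Q_span (@monomials R k n a) 1.
Proof.
move=> k0; rewrite -(kroot1 R k); have := @monomial_span R k n a (fun=> 0%N) k0.
by rewrite /monomial big1// => i _; rewrite expn0.
Qed.

Lemma monomials_spanM (R : realType) k n (a : 'I_n -> nat) : (0 < k)%N ->
  forall x y, Q_span (@monomials R k n a) x -> Q_span (@monomials R k n a) y ->
    Q_span (@monomials R k n a) (x * y).
Proof.
move=> k0 x y [c ->] [d ->]; rewrite mulr_suml; apply: Q_span_sum => i.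
rewrite -mulrA; apply: Q_spanZ; rewrite mulr_sumr; apply: Q_span_sum => j.
by rewrite mulrCA -krootM monomialM; apply: Q_spanZ; exact: monomial_span.
Qed.

Lemma radical_field_span (R : realType) k n (a : 'I_n -> nat) : (0 < k)%N ->
  radical_field k a = Q_span (@monomials R k n a).
Proof.
move=> k0; have M1 := @monomials_span1 R k n a k0; have MM := @monomials_spanM R k n a k0.
apply/seteqP; split.
  apply: radical_field_sub.
    split; first by rewrite inE.
    - move=> x y; rewrite !inE => xa ya; apply: Q_spanD => //.
      by rewrite -mulN1r -(rmorphN1 ratr); exact: Q_spanZ.
    - by move=> x y; rewrite !inE => xa ya; apply: (MM) => //; exact: (Q_span_inv M1 MM).
  move=> i; have := @monomial_span R k n a (fun j => (j == i : nat)) k0.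
  rewrite /monomial (bigD1 i)//= eqxx expn1 big1 ?muln1// => j /negPf ->.
  by rewrite expn0.
have Kf := @subfield_radical_field R k n a.
move=> x [c ->]; apply: (subfield_sum Kf) => j; apply: (subfieldM Kf).
  exact: (subfield_ratr Kf).
rewrite /monomials kroot_prod; apply: (subfield_prod Kf) => i.
by rewrite krootX; apply: (subfieldX Kf); exact: radical_field_gen.
Qed.

(** The diagonal value 1 forces [p i] to be prime, since [logn] vanishes at other numbers. The
    exponents of a monomial in the [a i] are its valuations at these primes. *)
Definition private_primes n (a p : 'I_n -> nat) : Prop :=
  forall i j, logn (p i) (a j) = (i == j).

Lemma logn_monomial n (a p e : 'I_n -> nat) i : (forall i, 0 < a i)%N ->
  private_primes a p -> logn (p i) (monomial a e) = e i.
Proof.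
move=> a0 ap.
have -> : logn (p i) (monomial a e) = (\sum_j e j * logn (p i) (a j))%N.
  rewrite /monomial.
  elim: (index_enum _) => [|j s IH]; first by rewrite !big_nil logn1.
  rewrite !big_cons lognM ?expn_gt0 ?a0 ?prodn_gt0// ?lognX ?IH// => l.
  by rewrite expn_gt0 a0.
rewrite (bigD1 i)//= ap eqxx muln1 big1 ?addn0// => j ji.
by rewrite ap eq_sym (negPf ji) muln0.
Qed.


(** The ratio of the two roots has the rational [k]-th power [b / c], so a nonzero trace forces it
    to be rational, and [kroot_ratio_logn] applies. *)
Lemma radical_field_trace (R : realType) k n (a : 'I_n -> nat) : (0 < k)%N ->
  exists t : R -> rat,
    [/\ forall (I : finType) (c : I -> rat) (x : I -> R),
          (forall i, radical_field k a (x i)) ->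
          t (\sum_i ratr (c i) * x i) = \sum_i c i * t (x i),
        t 1 != 0 &
        forall b c, (0 < b)%N -> (0 < c)%N ->
          radical_field k a (kroot k b / kroot k c : R) ->
          t (kroot k b / kroot k c) <> 0 ->
          forall p, logn p b = logn p c %[mod k]].
Proof.
move=> k0; have [N [e [ef eE]]] := Q_span_basis (@monomials R k n a).
have M1 := @monomials_span1 R k n a k0; have MM := @monomials_spanM R k n a k0.
have [||t [tL t1 tI]] := radical_trace ef _ _ k0; rewrite ?eE//.
rewrite radical_field_span//; exists t; split=> //.
  by move=> I c x ax; apply: tL => i; rewrite eE.
move=> b c b0 c0 bc tbc p; have c1 := kroot_gt0 R k c0.
have [Eq|irr] := pselect (exists q, kroot k b / kroot k c = ratr q :> R).
  move: Eq => [q] /(congr1 ( *%R^~ (kroot k c))); rewrite divfK ?gt_eqF// => Eq.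
  exact: kroot_ratio_logn Eq p.
case: tbc; apply: tI; rewrite ?eE ?divr_gt0 ?kroot_gt0//.
  by exists (b%:R / c%:R); rewrite expr_div_n !kroot_expn// fmorph_div /= !ratr_nat.
by move=> q; apply/eqP => Eq; apply: irr; exists q.
Qed.

(** A linear relation is divided by its [j]-th monomial and traced. Distinct monomials have
    different valuations modulo [k] at some private prime, so their ratio has trace zero; what
    remains is [c j * t 1 = 0]. *)
Lemma degree_private_primes (R : realType) k n (a p : 'I_n -> nat) :
    (0 < k)%N -> (forall i, 0 < a i)%N -> private_primes a p ->
  has_degree (radical_field k a : set R) (k ^ n).
Proof.
move=> k0 a0 ap; have -> : (k ^ n = #|{ffun 'I_n -> 'I_k}|)%N.
  by rewrite card_ffun !card_ord.
have [t [tL t1 tI]] := @radical_field_trace R k n a k0.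
exists (@monomials R k n a); split; last by rewrite radical_field_span.
move=> c c0 j; have Kf := @subfield_radical_field R k n a.
have mK i : radical_field k a (@monomials R k n a i).
  by rewrite radical_field_span//; exact: Q_span_gen.
have m0 (i : 'I_#|{ffun 'I_n -> 'I_k}|) :
    (0 < monomial a (fun l => enum_val i l))%N by exact: monomial_gt0.
have mR0 := kroot_gt0 R k (m0 j).
have := tL _ c (fun i => @monomials R k n a i / @monomials R k n a j).
have -> : \sum_i ratr (c i) * (@monomials R k n a i / @monomials R k n a j) = 0.
  by under eq_bigr do rewrite mulrA; rewrite -mulr_suml c0 mul0r.
have mjK i : radical_field k a (@monomials R k n a i / @monomials R k n a j).
  by apply: (subfieldM Kf) => //; exact: (subfieldV Kf).
move=> /(_ mjK); rewrite (bigD1 j)//= big1 ?addr0.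
  (* The empty sum gives [t 0 = 0]. *)
  rewrite divff ?gt_eqF// => /eqP; have := tL 'I_0 (fun=> 0) (fun=> 0).
  rewrite !big_ord0 => -> []//; rewrite eq_sym mulf_eq0 (negPf t1) orbF.
  by move/eqP.
move=> i ij; apply/eqP; rewrite mulf_eq0; apply/orP; right; apply/eqP.
apply: contrapT => ti; case/eqP: ij; apply: enum_val_inj; apply/ffunP => l.
apply/val_inj; have := tI _ _ (m0 i) (m0 j) (mjK i) ti (p l).
by rewrite !(logn_monomial _ _ a0 ap) !modn_small.
Qed.

(** Expand the root of [b] in the monomials, divide by it and take traces: since [t 1 <> 0], some
    ratio of a monomial to the root has nonzero trace. *)
Lemma kroot_in_radical_field (R : realType) k n (a : 'I_n -> nat) b :
    (0 < k)%N -> (forall i, 0 < a i)%N -> (0 < b)%N ->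
    radical_field k a (kroot k b : R) ->
  exists e : 'I_n -> nat, (forall i, e i < k)%N /\
    forall p, logn p b = logn p (monomial a e) %[mod k].
Proof.
move=> k0 a0 b0 Kb; have [t [tL t1 tI]] := @radical_field_trace R k n a k0.
have Kf := @subfield_radical_field R k n a.
have mK i : radical_field k a (@monomials R k n a i).
  by rewrite radical_field_span//; exact: Q_span_gen.
have m0 (i : 'I_#|{ffun 'I_n -> 'I_k}|) :
    (0 < monomial a (fun l => enum_val i l))%N by exact: monomial_gt0.
suff [j tj] : exists j, t (@monomials R k n a j / kroot k b) <> 0.
  exists (fun l => nat_of_ord (enum_val j l)); split=> // p; symmetry.
  apply: (tI _ _ (m0 j) b0 _ tj p).
  by apply: (subfieldM Kf); [exact: (mK j) | exact: (subfieldV Kf)].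
apply: contrapT => /forallNP t0; have bR := kroot_gt0 R k b0.
have : radical_field k a (kroot k b : R) by [].
rewrite {1}radical_field_span// => -[c bE].
have := tL _ c (fun i => @monomials R k n a i / kroot k b).
rewrite [X in _ = X]big1 => [|i _].
  under eq_bigr do rewrite mulrA.
  rewrite -mulr_suml -bE divff ?gt_eqF// => t10; case/eqP: t1; apply: t10 => i.
  by apply: (subfieldM Kf) => //; exact: (subfieldV Kf).
by have /contrapT -> := t0 i; rewrite mulr0.
Qed.

(** * Counting k-free integers *)

Section KFree.
Local Open Scope nat_scope.

Definition kfree (k m : nat) : bool :=
  (0 < m) && all (fun p => logn p m < k) (primes m).

Lemma kfreeP k m : 0 < k ->
  reflect (0 < m /\ forall p, logn p m < k) (kfree k m).
Proof.
move=> k0; apply: (iffP andP) => -[m0 mk]; split=> //; last by apply/allP.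
move=> p; have [/(allP mk)//|] := boolP (p \in primes m).
by rewrite -logn_gt0 -eqn0Ngt => /eqP ->.
Qed.

Lemma kfree_eq k a b : 0 < k -> kfree k a -> kfree k b ->
  (forall p, logn p a = logn p b %[mod k]) -> a = b.
Proof.
move=> k0 /(kfreeP _ k0)[a0 ak] /(kfreeP _ k0)[b0 bk] ab.
by apply: eqn_from_log => // p; have := ab p; rewrite !modn_small.
Qed.

(** The witness [d] is the largest integer whose [k]-th power divides [m]: if [p^k] divided the
    cofactor, [d * p] would do better. *)
Lemma kfree_decomp k m : 0 < k -> 0 < m ->
  exists d f, [/\ 0 < d, kfree k f & m = d ^ k * f].
Proof.
move=> k0 m0.
have P1 : exists d, (0 < d) && (d ^ k %| m) by exists 1; rewrite exp1n dvd1n.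
have Pub d : (0 < d) && (d ^ k %| m) -> d <= m.
  move=> /andP[d0 /(dvdn_leq m0)]; apply: leq_trans.
  by rewrite -{1}(expn1 d) leq_pexp2l.
case: (ex_maxnP P1 Pub) => d /andP[d0 /dvdnP[f mE]] dmax.
have f0 : 0 < f by case: f mE m0 => // ->.
exists d, f; split=> //; last by rewrite mulnC.
apply/kfreeP => //; split=> // p.
rewrite ltnNge; apply/negP => kp.
have pp : prime p by move: (leq_trans k0 kp); rewrite logn_gt0 mem_primes => /andP[].
have := dmax (d * p); rewrite muln_gt0 d0 prime_gt0//= mE expnMn mulnC.
rewrite dvdn_mul// ?pfactor_dvdn// => /(_ isT).
by rewrite leqNgt ltn_Pmulr ?prime_gt1.
Qed.

Lemma kfree_decomp_uniq k d d' f f' : 0 < k -> 0 < d -> 0 < d' ->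
  kfree k f -> kfree k f' -> d ^ k * f = d' ^ k * f' -> d = d'.
Proof.
move=> k0 d0 d0' /(kfreeP _ k0)[f0 fk] /(kfreeP _ k0)[f0' fk'] E.
apply: eqn_from_log => // p; move: (congr1 (fun m => logn p m %/ k) E).
rewrite /= !lognM ?expn_gt0 ?d0 ?d0'// !lognX ![k * _]mulnC.
by rewrite !divnMDl// !divn_small ?addn0.
Qed.

(** The integers from 1 to [N] are encoded as [m.+1] with [m < N], here and in the later counts. The
    operation is arbitrary because both natural and real sums are rewritten this way. *)
Lemma big_multiples (T : Type) (idx : T) (op : Monoid.law idx) D N (F : nat -> T) :
  0 < D -> \big[op/idx]_(0 <= m < N | D %| m.+1) F m.+1 =
           \big[op/idx]_(0 <= j < N %/ D) F (D * j.+1).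
Proof.
move=> D0; elim: N => [|N IH]; first by rewrite div0n !big_geq.
rewrite big_mkcond big_nat_recr//= -big_mkcond IH divnS//.
case: ifP => DN; last by rewrite add0n Monoid.mulm1.
rewrite add1n big_nat_recr//=; congr (op _ (F _)).
by have := divnK DN; rewrite divnS// DN add1n mulnC => ->.
Qed.

Definition kfree_count (k N : nat) : nat := \sum_(0 <= m < N) kfree k m.+1.

(** The integers up to [N] are sorted by the [d] of their unique decomposition [d ^ k * f] with [f]
    [k]-free. *)
Lemma sum_kfree_count k N D : 0 < k -> N <= D ->
  \sum_(0 <= d < D) kfree_count k (N %/ d.+1 ^ k) = N.
Proof.
move=> k0 ND.
transitivity (\sum_(0 <= d < D) \sum_(0 <= m < N | d.+1 ^ k %| m.+1)
    (kfree k (m.+1 %/ d.+1 ^ k) : nat)).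
  apply: eq_bigr => d _; have dk : 0 < d.+1 ^ k by rewrite expn_gt0.
  rewrite (@big_multiples _ _ addn _ N (fun m => (kfree k (m %/ d.+1 ^ k) : nat)) dk).
  by apply: eq_bigr => j _; rewrite mulKn.
rewrite (exchange_big_dep_nat xpredT)//=.
transitivity (\sum_(0 <= m < N) 1); last by rewrite sum_nat_const_nat muln1 subn0.
apply: eq_big_nat => m /andP[_ mN].
have [d [f [d0 fk mE]]] := @kfree_decomp k m.+1 k0 isT.
(* The index [d.-1] is in range because [d <= d ^ k * f = m.+1 <= N <= D]. *)
have dD : d.-1 < D.
  apply: leq_trans ND; rewrite prednK//; apply: leq_trans mN.
  rewrite mE; have [f0 _] := kfreeP f k0 fk.
  by apply: leq_trans (leq_pmulr _ f0); rewrite -{1}(expn1 d) leq_pexp2l.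
rewrite big_mkord (bigD1 (Ordinal dD))/=; last by rewrite prednK// mE dvdn_mulr.
rewrite prednK// {1}mE mulKn ?expn_gt0 ?d0// fk.
rewrite big1 ?addn0// => e /andP[edvd eD]; apply/eqP; rewrite eqb0.
apply: contra eD => ek; apply/eqP/val_inj => /=.
suff -> : d = e.+1 by [].
apply: (kfree_decomp_uniq k0 d0 _ fk ek) => //.
by rewrite -mE mulnC divnK.
Qed.

End KFree.

(** * Partial sums of the zeta series and the density of k-free integers *)

Lemma sum_inv_sqr_le (R : realFieldType) (y M : nat) : (0 < y)%N ->
  \sum_(y <= d < M) (d.+1%:R ^+ 2)^-1 <= y%:R^-1 :> R.
Proof.
move=> y0; have [My|yM] := leqP M y; first by rewrite big_geq// invr_ge0 ler0n.
(* The induction proves this sharper telescoping bound, from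
   [1 / (z + 1)^2 <= 1 / z - 1 / (z + 1)]. *)
apply: (@le_trans _ _ (y%:R^-1 - M%:R^-1)); last by rewrite gerBl invr_ge0 ler0n.
elim: M yM => // M IH; rewrite ltnS leq_eqVlt => /predU1P[<-|yM].
  rewrite big_nat1; have y0' : 0 < y%:R :> R by rewrite ltr0n.
  rewrite -natr1; set z := y%:R in y0' *.
  have -> : z^-1 - (z + 1)^-1 = (z * (z + 1))^-1 by field; lra.
  by rewrite lef_pV2 ?posrE; nra.
rewrite big_nat_recr 1?ltnW//=; move/(_ yM) in IH.
have M0' : 0 < M%:R :> R by rewrite ltr0n; lia.
have : (M.+1%:R ^+ 2)^-1 <= M%:R^-1 - M.+1%:R^-1 :> R.
  rewrite -natr1; set z := M%:R in M0' *.
  have -> : z^-1 - (z + 1)^-1 = (z * (z + 1))^-1 by field; lra.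
  by rewrite lef_pV2 ?posrE; nra.
by move=> h; apply: le_trans (lerD IH h) _; rewrite addrA subrK.
Qed.

Section Zeta.
Variables (R : realType) (k : nat).
Hypothesis k2 : (2 <= k)%N.

Let u : R ^nat := fun m : nat => m.+1%:R `^ (- k%:R).

Lemma zeta_termE m : u m = (m.+1%:R ^+ k)^-1.
Proof. by rewrite /u powRN powR_mulrn. Qed.

Lemma zeta_term_le m : u m <= (m.+1%:R ^+ 2)^-1.
Proof.
rewrite zeta_termE lef_pV2 ?posrE ?exprn_gt0// -!natrX ler_nat.
by rewrite leq_pexp2l.
Qed.

(** The limit defining [zeta] carries information only once convergence is known; the partial sums
    increase and stay below 2. *)
Lemma zeta_cvg : series u @ \oo --> zeta k%:R.
Proof.
apply: nondecreasing_is_cvgn.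
  by apply: nondecreasing_series => m _ _; rewrite powR_ge0.
exists 2 => _ [m _ <-]; rewrite /series /=.
case: m => [|m]; first by rewrite big_geq.
rewrite big_ltn// (_ : 2 = 1 + 1)//; apply: lerD.
  by rewrite zeta_termE expr1n invr1.
apply: le_trans (_ : _ <= 1%:R^-1) _; last by rewrite invr1.
apply: le_trans (@sum_inv_sqr_le R 1 m.+1 isT).
by apply: ler_sum => i _; exact: zeta_term_le.
Qed.

Lemma zeta_ge_partial D : \sum_(0 <= d < D) (d.+1%:R ^+ k)^-1 <= zeta k%:R :> R.
Proof.
under eq_bigr do rewrite -zeta_termE.
apply: (nondecreasing_cvgn_le _ zeta_cvg D).
by apply: nondecreasing_series => m _ _; rewrite powR_ge0.
Qed.

Lemma zeta_ge1 : 1 <= zeta k%:R :> R.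
Proof.
have := zeta_ge_partial 1; rewrite big_nat1 expr1n invr1; exact.
Qed.

Lemma zeta_partial_near (e : R) (N : nat) : 0 < e -> exists2 D, (N <= D)%N &
  zeta k%:R - \sum_(0 <= d < D) (d.+1%:R ^+ k)^-1 <= e.
Proof.
move=> e0; have /cvgrPdist_le/(_ _ e0)[D _ DP] := zeta_cvg.
exists (maxn D N); first by rewrite leq_maxr.
have := DP (maxn D N) (leq_maxl _ _) => /=; rewrite /series /=.
by under eq_bigr do rewrite zeta_termE; apply: le_trans; exact: ler_norm.
Qed.

End Zeta.

Lemma sum_inv_sqr_from2_le (R : realFieldType) (M : nat) :
  \sum_(1 <= d < M) (d.+1%:R ^+ 2)^-1 <= 3 / 4 :> R.
Proof.
have [M1|M1] := leqP M 1; first by rewrite big_geq// divr_ge0.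
rewrite big_ltn//; have := @sum_inv_sqr_le R 2 M isT; lra.
Qed.

(* With [E x = F x - x / zeta k], the identity [sum_d F (x / d^k) = floor x]
   gives [|E x| <= 2 + sum_(d >= 2) |E (x / d^k)|], and the bound
   [8 x^(2/3)] reproduces itself because [sum_(d >= 2) d^-2 <= 3/4]. *)
Lemma kfree_count_asymptotic (R : realType) (k : nat) : (3 <= k)%N ->
  forall (N : nat) (x : R), N%:R <= x < N.+1%:R ->
    `|(kfree_count k N)%:R - x / zeta k%:R| <= 8 * x `^ (2 / 3).
Proof.
move=> k3; have k2 : (2 <= k)%N by lia.
have z1 := @zeta_ge1 R k k2; set z := zeta _ in z1 *.
have z0 : 0 < z by lra.
elim/ltn_ind => N IH x /andP[Nx xN].
have x0 : 0 <= x := le_trans (ler0n _ _) Nx.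
have [N0|N0] := posnP N.
  rewrite N0 /kfree_count big_geq// sub0r normrN ger0_norm; last first.
    by rewrite divr_ge0// ltW.
  apply: (@le_trans _ _ x); first by rewrite ler_pdivrMr// ler_peMr.
  have x1 : x <= 1 by move: xN; rewrite N0 => /ltW.
  have [->|xn0] := eqVneq x 0; first by rewrite mulr_ge0// powR_ge0.
  have xgt0 : 0 < x by rewrite lt_neqAle eq_sym xn0.
  apply: (@le_trans _ _ (x `^ (2 / 3))); last by rewrite ler_peMl ?powR_ge0//; lra.
  by rewrite -{1}(powRr1 x0) ger_powR ?xgt0//; lra.
have x1 : 1 <= x by apply: le_trans Nx; rewrite ler1n.
(* The cutoff is at least [N], for [sum_kfree_count], and so far out that dropping the tail of the
   zeta series costs at most 1. *)
have [D ND Dz] : exists2 D, (N <= D)%N &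
    x * (z - \sum_(0 <= d < D) (d.+1%:R ^+ k)^-1) <= 1.
  have x0' : 0 < x by lra.
  have [|D ND Dz] := @zeta_partial_near R k k2 x^-1 N; first by rewrite invr_gt0.
  by exists D => //; rewrite mulrC -ler_pdivlMr ?mul1r// div1r.
have Dz0 := @zeta_ge_partial R k k2 D; rewrite -/z in Dz0.
set s := \sum_(0 <= d < D) _ in Dz Dz0.
have D0 : (0 < D)%N by lia.
pose E d : R := (kfree_count k (N %/ d.+1 ^ k))%:R - x / d.+1%:R ^+ k / z.
have E0 : E 0%N = (kfree_count k N)%:R - x / z.
  by rewrite /E exp1n divn1 expr1n divr1.
have Esum : \sum_(0 <= d < D) E d = N%:R - x * s / z.
  rewrite /E sumrB -natr_sum sum_kfree_count//; last lia.
  by congr (_ - _); rewrite -!mulr_suml -mulr_sumr.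
have Etot : `|\sum_(0 <= d < D) E d| <= 2.
  rewrite Esum; have -> : N%:R - x * s / z = (N%:R - x) + x * (z - s) / z.
    by field; lra.
  apply: le_trans (ler_normD _ _) _; rewrite (_ : 2 = 1 + 1)//; apply: lerD.
    by rewrite ler0_norm; move: xN; rewrite -natr1; lra.
  rewrite ger0_norm; last by rewrite divr_ge0// ?mulr_ge0//; lra.
  by rewrite ler_pdivrMr// mul1r; lra.
(* The induction hypothesis at [x / d.+1 ^ k] yields a power of [d.+1] of exponent [- 2 k / 3],
   which is at most [- 2] because [k >= 3]. *)
have Ed d : (0 < d)%N -> `|E d| <= 8 * x `^ (2 / 3) * (d.+1%:R ^+ 2)^-1.
  move=> d0; rewrite /E; set q := (d.+1 ^ k)%N.
  have q2 : (1 < q)%N by rewrite -(exp1n k) ltn_exp2r//; lia.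
  have qR : d.+1%:R ^+ k = q%:R :> R by rewrite natrX.
  rewrite qR; apply: le_trans (IH (N %/ q)%N _ (x / q%:R) _) _.
  - by rewrite ltn_Pdiv.
  - have q0 : 0 < q%:R :> R by rewrite ltr0n; lia.
    rewrite ler_pdivlMr// ltr_pdivrMr// -!natrM; apply/andP; split.
      by apply: le_trans Nx; rewrite ler_nat leq_trunc_div.
    apply: lt_le_trans xN _; rewrite ler_nat; apply: ltn_ceil; lia.
  rewrite -mulrA ler_pM2l// powRM ?invr_ge0// ler_wpM2l ?powR_ge0//.
  rewrite -qR -powR_mulrn// -powRN -powRrM -powR_mulrn// -powRN.
  by apply: ler_powR; rewrite ?ler1n//; move: k3; rewrite -(ler_nat R); lra.
have -> : (kfree_count k N)%:R - x / z =
    \sum_(0 <= d < D) E d - \sum_(1 <= d < D) E d.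
  by rewrite big_ltn// E0 addrK.
apply: le_trans (ler_normB _ _) _.
have x23 : 1 <= x `^ (2 / 3).
  by rewrite -[X in X <= _](powRr0 x); apply: ler_powR => //; rewrite divr_ge0.
have : `|\sum_(1 <= d < D) E d| <= 8 * x `^ (2 / 3) * (3 / 4).
  apply: le_trans (ler_norm_sum _ _ _) _.
  apply: (@le_trans _ _ (\sum_(1 <= d < D) 8 * x `^ (2 / 3) * (d.+1%:R ^+ 2)^-1)).
    by rewrite !big_nat; apply: ler_sum => d /andP[d0 _]; exact: Ed.
  by rewrite -mulr_sumr ler_wpM2l ?sum_inv_sqr_from2_le// mulr_ge0// powR_ge0.
(* [2 + 6 x^(2/3) <= 8 x^(2/3)], as [x >= 1]. *)
by lra.
Qed.

(** * Counting smooth integers *)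

Section CentralBinomial.
Local Open Scope nat_scope.

Lemma prod_primes_dvdn (s : seq nat) m : uniq s -> all prime s ->
  (forall p, p \in s -> p %| m) -> \prod_(p <- s) p %| m.
Proof.
elim: s => [|p s IH] /=; first by rewrite big_nil dvd1n.
move=> /andP[ps us] /andP[pp sp] sm; rewrite big_cons Gauss_dvd.
  by rewrite sm ?mem_head//= IH// => q qs; rewrite sm// in_cons qs orbT.
rewrite prime_coprime// Euclid_dvd_prod// big_has; apply: contra ps => /hasP[q qs].
by rewrite dvdn_prime2//; [move=> /eqP -> | exact: (allP sp)].
Qed.

Lemma prime_dvd_fact p m : prime p -> p %| m`! -> p <= m.
Proof.
move=> pp; elim: m => [|m IH]; first by rewrite fact0 dvdn1 => /eqP p1; rewrite p1 in pp.
rewrite factS Euclid_dvdM// => /orP[/dvdn_leq->//|/IH/leq_trans]; exact.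
Qed.

Lemma prime_dvd_central_bin p m : prime p -> m < p <= m + m -> p %| 'C(m + m, m).
Proof.
move=> pp /andP[mp pm].
have : p %| (m + m)`! by rewrite dvdn_fact// prime_gt0.
rewrite -(@bin_fact (m + m) m) ?leq_addr// addnK Euclid_dvdM// => /orP[//|].
by rewrite Euclid_dvdM// orbb => /(prime_dvd_fact pp); rewrite leqNgt mp.
Qed.

Lemma bin_leq_exp2 m j : 'C(m, j) <= 2 ^ m.
Proof.
have [mj|jm] := ltnP m j; first by rewrite bin_small.
rewrite -[2]/(1 + 1) expnDn (bigD1 (Ordinal (jm : j < m.+1)))//= !exp1n !muln1.
exact: leq_addr.
Qed.

(** Chebyshev's argument: with [n = 2 ^ i], the primes in [(n, 2n]] all divide the central binomial
    coefficient, which is at most [2 ^ (2n)], while each of them exceeds [n]. *)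
Lemma dyadic_primes_bound i :
  i * \sum_(2 ^ i <= m < 2 ^ i.+1) prime m.+1 <= 2 ^ i.+1.
Proof.
set n := 2 ^ i; have -> : 2 ^ i.+1 = n + n by rewrite expnS mul2n addnn.
pose s := [seq p <- iota n.+1 n | prime p].
have -> : \sum_(n <= m < n + n) prime m.+1 = size s.
  rewrite size_filter -sum1_count [RHS]big_mkcond -[X in \sum_(_ <= _ < X) _]/((n + n).+1.-1).
  rewrite -(big_add1 _ _ _ _ xpredT (fun m => prime m : nat)) /index_iota subSS addnK.
  by apply: eq_bigr => p _; case: prime.
have sP p : p \in s -> prime p /\ n < p <= n + n.
  by rewrite mem_filter mem_iota addSn ltnS => /and3P[-> -> ->].
have n_s : n ^ size s <= \prod_(p <- s) p.
  have : all (leq n) s by apply/allP => p /sP[_ /andP[/ltnW]].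
  elim: (s) => [|p t IH] /=; first by rewrite big_nil.
  by move=> /andP[np /IH nt]; rewrite big_cons expnS leq_mul.
have s_bin : \prod_(p <- s) p <= 'C(n + n, n).
  apply: dvdn_leq; first by rewrite bin_gt0 leq_addr.
  apply: prod_primes_dvdn; rewrite ?filter_uniq ?iota_uniq//.
    by apply/allP => p /sP[].
  by move=> p /sP[]; exact: prime_dvd_central_bin.
have := leq_trans (leq_trans n_s s_bin) (bin_leq_exp2 _ _).
by rewrite /n -expnM leq_exp2l.
Qed.

End CentralBinomial.

(** A form of Mertens' bound: the primes between [2 ^ i] and [2 ^ i.+1] contribute at most [2 / i],
    and the harmonic sum over [i] is compared with the logarithm. *)
Lemma sum_inv_primes_le (R : realType) J : (0 < J)%N ->
  \sum_(0 <= m < 2 ^ J.+1 | prime m.+1) m.+1%:R^-1 <= 3 + 2 * ln J%:R :> R.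
Proof.
have step i : (0 < i)%N ->
    \sum_(2 ^ i <= m < 2 ^ i.+1 | prime m.+1) m.+1%:R^-1 <= 2 / i%:R :> R.
  move=> i0; set n := (2 ^ i)%N; have n0 : 0 < n%:R :> R by rewrite ltr0n expn_gt0.
  apply: (@le_trans _ _ (\sum_(n <= m < 2 ^ i.+1) (prime m.+1)%:R / n%:R)).
    rewrite big_mkcond !big_nat; apply: ler_sum => m /andP[nm _].
    case: prime; last by rewrite mul0r.
    by rewrite mul1r lef_pV2 ?posrE// ler_nat ltnW.
  rewrite -mulr_suml -natr_sum ler_pdivrMr// mulrAC ler_pdivlMr ?ltr0n//.
  rewrite -!natrM ler_nat mulnC; apply: leq_trans (dyadic_primes_bound i) _.
  by rewrite expnS.
elim: J => // -[_ _|J IH _].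
  rewrite ln1 mulr0 addr0 (@big_cat_nat _ _ _ (2 ^ 1)%N)//=.
  have := step 1%N isT; rewrite divr1 => le1.
  have : \sum_(0 <= m < 2 ^ 1 | prime m.+1) m.+1%:R^-1 <= 1 :> R.
    by rewrite expn1 big_mkcond /= 2?big_ltn// big_geq//=; lra.
  lra.
rewrite (@big_cat_nat _ _ _ (2 ^ J.+2)%N) ?leq_exp2l//=.
apply: le_trans (lerD (IH isT) (step J.+2 isT)) _.
rewrite -addrA lerD2l -mulrDr ler_pM2l//.
have J1 : 0 < J.+1%:R :> R by []; have J2 : 0 < J.+2%:R :> R by [].
have : ln (1 - J.+2%:R^-1) <= - J.+2%:R^-1 :> R.
  by apply: le_ln1Dx; rewrite ltrN2 invf_lt1// ltr1n.
have -> : 1 - J.+2%:R^-1 = J.+1%:R / J.+2%:R :> R.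
  by rewrite -[J.+2%:R]natr1; move: J.+1%:R J1 => z z0; field; lra.
rewrite ln_div ?posrE//.
by move: (ln J.+1%:R) (ln J.+2%:R) (J.+2%:R^-1) => a b c; lra.
Qed.

(** * Smooth integers and Rankin's trick *)

Definition smooth (y m : nat) : bool := all (fun p => p <= y)%N (primes m).

Definition smooth_count (N y : nat) : nat := \sum_(0 <= m < N) smooth y m.+1.

Lemma smooth0 m : smooth 0 m.+1 -> m = 0%N.
Proof.
case: m => // m /allP/(_ (pdiv m.+2)); rewrite mem_primes pdiv_prime// pdiv_dvd.
by move=> /(_ isT); rewrite leqNgt pdiv_gt0.
Qed.

Lemma smoothS_dvd y m : smooth y.+1 m -> ~~ ((prime y.+1) && (y.+1 %| m)%N) ->
  smooth y m.
Proof.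
move=> /allP sm npm; apply/allP => p pm; move: (sm p pm).
rewrite leq_eqVlt ltnS => /predU1P[py|//]; move: pm npm.
by rewrite mem_primes py => /and3P[-> _ ->].
Qed.

Lemma smoothM y a b : (0 < a)%N -> (0 < b)%N -> smooth y (a * b) -> smooth y b.
Proof.
move=> a0 b0 /allP sm; apply/allP => p pb; apply: sm.
by rewrite primesM// pb orbT.
Qed.

(** [(1 + 4 t) (1 - t) = 1 + t (3 - 4 t)] is at least 1 up to [t = 3 / 4]. *)
Lemma inv1B_le_expR (R : realType) (t : R) : 0 <= t <= 3 / 4 ->
  (1 - t)^-1 <= expR (4 * t).
Proof.
move=> /andP[t0 t1]; have := expR_ge1Dx (4 * t).
by apply: le_trans; rewrite -div1r ler_pdivrMr; nra.
Qed.

(** An Euler product built one prime at a time: with [t] the term of the new prime, splitting off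
    its multiples gives [T y.+1 <= T y + t * T y.+1], hence a factor
    [(1 - t)^-1 <= expR (4 * t)]. *)
Lemma smooth_sum_le (R : realType) (s : R) N y : 2^-1 <= s ->
  \sum_(0 <= m < N | smooth y m.+1) m.+1%:R `^ (- s) <=
  expR (4 * \sum_(0 <= m < y | prime m.+1) m.+1%:R `^ (- s)).
Proof.
move=> s12; elim: y => [|y IH].
  rewrite [X in 4 * X]big_geq// mulr0 expR0.
  case: N => [|N]; first by rewrite big_geq.
  rewrite big_mkcond big_ltn//= big_nat big1 ?addr0 => [|m /andP[m0 _]]; last first.
    by case: ifP => // /smooth0 m0'; rewrite m0' in m0.
  by rewrite powR1.
pose T z := \sum_(0 <= m < N | smooth z m.+1) m.+1%:R `^ (- s) : R.
rewrite -/(T y) in IH; rewrite -/(T y.+1).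
rewrite big_mkcond big_nat_recr//= -big_mkcond.
have [py|npy] := boolP (prime y.+1); last first.
  rewrite addr0; apply: le_trans IH; rewrite /T big_mkcond [leRHS]big_mkcond.
  apply: ler_sum => m _; case: ifP => [sm|_]; last by case: ifP => // _; rewrite powR_ge0.
  by rewrite (smoothS_dvd sm)// (negPf npy).
set t := y.+1%:R `^ (- s).
have t0 : 0 <= t by exact: powR_ge0.
(* As [y.+1 >= 2] and [s >= 1 / 2], [t^2 <= 1 / 2 < 9 / 16]. *)
have t34 : t <= 3 / 4.
  have y2 : 2 <= y.+1%:R :> R by rewrite ler_nat prime_gt1.
  have tle : t <= y.+1%:R `^ (- 2^-1) by apply: ler_powR; rewrite ?ler1n//; lra.
  have : (y.+1%:R `^ (- 2^-1)) ^+ 2 <= 2^-1 :> R.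
    rewrite -powR_mulrn ?powR_ge0// -powRrM (_ : - 2^-1 * 2%:R = -1); last by lra.
    by rewrite powR_inv1// lef_pV2// posrE; lra.
  by have := powR_ge0 (y.+1%:R : R) (- 2^-1); nra.
have recT : T y.+1 <= T y + t * T y.+1.
  rewrite {1}/T (bigID (fun m => y.+1 %| m.+1)%N)/= addrC; apply: lerD.
    rewrite /T [leLHS]big_mkcond [leRHS]big_mkcond; apply: ler_sum => m _.
    case: ifP => [/andP[sm ym]|_]; last by case: ifP => // _; rewrite powR_ge0.
    by rewrite (smoothS_dvd sm)// negb_and ym orbT.
  pose F m : R := if smooth y.+1 m then m%:R `^ (- s) else 0.
  rewrite (eq_bigl (fun m => (y.+1 %| m.+1)%N && smooth y.+1 m.+1)) => [|m];
    last by rewrite andbC.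
  rewrite big_mkcondr (@big_multiples _ _ _ y.+1 N F)// /T.
  rewrite mulr_sumr [leRHS]big_mkcond.
  apply: (@le_trans _ _ (\sum_(0 <= j < N %/ y.+1)
      if smooth y.+1 j.+1 then t * j.+1%:R `^ (- s) else 0)).
    apply: ler_sum => j _; rewrite /F; case: ifP => [sm|_]; last first.
      by case: ifP => // _; rewrite mulr_ge0// powR_ge0.
    by rewrite (smoothM _ _ sm)// natrM powRM.
  rewrite [leRHS](@big_cat_nat _ _ _ (N %/ y.+1)) ?leq_div//= lerDl.
  by apply: sumr_ge0 => j _; case: ifP => // _; rewrite mulr_ge0// powR_ge0.
rewrite mulrDr expRD.
have : T y.+1 <= T y / (1 - t) by rewrite ler_pdivlMr; nra.
move=> /le_trans; apply; apply: ler_pM => //.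
- by rewrite sumr_ge0// => m _; exact: powR_ge0.
- by rewrite invr_ge0; lra.
- by apply: inv1B_le_expR; rewrite t0.
Qed.

(** Each smooth [m <= N] is given the weight [(N / m)^s >= 1]; then [p^(- s) <= y^(1 - s) / p] for
    every prime [p <= y]. *)
Lemma rankin_bound (R : realType) (s : R) N y : 2^-1 <= s <= 1 ->
  (smooth_count N y)%:R <= N%:R `^ s *
   expR (4 * (y%:R `^ (1 - s) * \sum_(0 <= m < y | prime m.+1) m.+1%:R^-1)).
Proof.
move=> /andP[s12 s1].
apply: (@le_trans _ _ (N%:R `^ s * \sum_(0 <= m < N | smooth y m.+1) m.+1%:R `^ (- s))).
  rewrite /smooth_count natr_sum mulr_sumr [leRHS]big_mkcond !big_nat.
  apply: ler_sum => m /andP[_ mN]; case: smooth => //.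
  rewrite powRN ler_pdivlMr ?powR_gt0// mul1r.
  by apply: ge0_ler_powR; rewrite ?nnegrE ?ler_nat//; lra.
rewrite ler_wpM2l ?powR_ge0//; apply: le_trans (smooth_sum_le _ _ s12) _.
rewrite ler_expR ler_pM2l// mulr_sumr [leLHS]big_nat_cond [leRHS]big_nat_cond.
apply: ler_sum => m /andP[/andP[_ my] _].
rewrite -(powR_inv1 (ler0n R m.+1)).
rewrite [X in X <= _](_ : _ = m.+1%:R `^ (1 - s + -1)); last first.
  by congr powR; lra.
rewrite powRD; last by rewrite pnatr_eq0 implybT.
rewrite ler_wpM2r ?powR_ge0//; apply: ge0_ler_powR; rewrite ?nnegrE ?ler_nat//; lra.
Qed.

(** * Good tuples *)

Definition good (k y n : nat) (a : 'I_n -> nat) : Prop :=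
  [/\ forall i, kfree k (a i),
      forall i, ~~ smooth y (a i),
      forall i p, prime p -> (y < p)%N -> (logn p (a i) <= 1)%N &
      forall i j p, prime p -> (y < p)%N -> (p %| a i)%N -> (p %| a j)%N -> i = j].

Lemma good_perm k y n (a : 'I_n -> nat) (s : {perm 'I_n}) :
  good k y a -> good k y (a \o s).
Proof.
move=> [a1 a2 a3 a4]; split=> /= [i|i|i|i j p pp yp pi pj].
- exact: a1.
- exact: a2.
- exact: a3.
- by apply/(perm_inj (s := s))/(a4 _ _ p).
Qed.

Lemma good_gt0 k y n (a : 'I_n -> nat) : good k y a -> forall i, (0 < a i)%N.
Proof. by move=> [a1 _ _ _] i; have /andP[] := a1 i. Qed.

Lemma good_private_primes k y n (a : 'I_n -> nat) : good k y a ->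
  exists p, private_primes a p /\ forall i, prime (p i) /\ (y < p i)%N.
Proof.
move=> ga; have a0 := good_gt0 ga; case: ga => [a1 a2 a3 a4].
have /choice[p pP] i : exists p, [/\ prime p, (p %| a i)%N & (y < p)%N].
  have /allPn[p] := a2 i; rewrite mem_primes -ltnNge => /and3P[pp _ pa] yp.
  by exists p.
exists p; split=> [i j|i]; last by have [] := pP i.
have [pp pa yp] := pP i; have [<-|ij] := eqVneq i j.
  by apply/eqP; rewrite eqn_leq a3// logn_gt0 mem_primes pp a0.
apply/eqP; rewrite -leqn0 leqNgt logn_gt0 mem_primes pp a0/=.
by apply: contra ij => pj; apply/eqP/(a4 _ _ (p i)).
Qed.

Lemma good_inj k y n (a : 'I_n -> nat) : good k y a -> injective a.
Proof.
move=> /good_private_primes[p [ap _]] i j aij; have := ap i i.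
by rewrite aij ap eqxx; case: eqVneq.
Qed.

Lemma good_degree (R : realType) k y n (a : 'I_n -> nat) : (0 < k)%N ->
  good k y a -> has_degree (radical_field k a : set R) (k ^ n).
Proof.
move=> k0 ga; have [p [ap _]] := good_private_primes ga.
exact: degree_private_primes k0 (good_gt0 ga) ap.
Qed.

Lemma radical_field_perm (R : realType) k n (a : 'I_n -> nat) (s : {perm 'I_n}) :
  radical_field k (a \o s) = radical_field k a :> set R.
Proof.
apply/seteqP; split; apply: radical_field_sub => [|i].
- exact: subfield_radical_field.
- exact: radical_field_gen.
- exact: subfield_radical_field.
- by have := @radical_field_gen R k n (a \o s) (s^-1 i)%g; rewrite /= permKV.
Qed.

(** By [kroot_in_radical_field], each [b j] has, modulo [k], the valuations of a monomial in [a]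
    with exponents [e j]. The matrix [e] turns out to be a permutation matrix. *)
Lemma good_same_field (R : realType) k y n (a b : 'I_n -> nat) : (0 < k)%N ->
    good k y a -> good k y b ->
    radical_field k b = radical_field k a :> set R ->
  exists s : {perm 'I_n}, b =1 a \o s.
Proof.
move=> k0 ga gb ab; have a0 := good_gt0 ga; have b0 := good_gt0 gb.
have [p [ap pP]] := good_private_primes ga.
have /choice[e eP] j : exists e : 'I_n -> nat, (forall i, e i < k)%N /\
    forall q, logn q (b j) = logn q (monomial a e) %[mod k].
  apply: (kroot_in_radical_field (R := R)) => //; rewrite -ab.
  exact: radical_field_gen.
case: (ga) (gb) => [a1 _ _ _] [b1 b2 b3 b4].
(* The prime [p i] reads off [e j i] exactly, as both sides are below [k]. *)
have eE i j : logn (p i) (b j) = e j i.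
  have := (eP j).2 (p i); rewrite (logn_monomial _ _ a0 ap) !modn_small//.
    exact: (eP j).1.
  by have /(kfreeP _ k0)[] := b1 j.
have pb i j : (0 < e j i)%N -> (p i %| b j)%N.
  by rewrite -eE logn_gt0 mem_primes => /and3P[].
(* A zero row would give [b j = 1], which is [y]-smooth. *)
have /choice[f fP] j : exists i, (0 < e j i)%N.
  apply: contrapT => /forallNP ej; case/negP: (b2 j).
  suff -> : b j = 1%N by [].
  apply: (kfree_eq k0 (b1 j)) => [|q]; first by [].
  rewrite (eP j).2 /monomial big1// => i _; move/negP: (ej i).
  by rewrite -eqn0Ngt => /eqP ->.
(* Two nonzero entries in one column would make a prime larger than [y] divide two entries of
   [b]. *)
have f_inj : injective f.
  move=> j j' fj; have [pp yp] := pP (f j).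
  by apply: (b4 _ _ (p (f j))) => //; apply: pb => //; rewrite fj.
exists (perm f_inj) => j; rewrite /= permE.
apply: (kfree_eq k0 (b1 j) (a1 (f j))) => q; rewrite (eP j).2.
rewrite /monomial (bigD1 (f j))//= big1 ?muln1 => [|i ij].
  have [pp yp] := pP (f j); have := b3 j _ pp yp; rewrite eE.
  by have := fP j; case: (e j (f j)) => [|[]].
(* Any other column is some [f j']; a nonzero entry of row [j] there would again make a large prime
   divide both [b j] and [b j']. *)
have [j' iE] : exists j', i = f j'.
  by exists ((perm f_inj)^-1 i)%g; rewrite -[X in f X]/(_) -(permE f_inj) permKV.
case: (posnP (e j i)) => [-> //|ei]; case/eqP: ij; rewrite iE; congr f.
have [pp yp] := pP i; apply: (b4 _ _ (p i)) => //; apply: pb => //.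
by rewrite iE.
Qed.

(** * From tuples to fields *)

(** The pairs [(u, x)] with [f x = u] are counted in two ways. A sequence lists the image because
    the fields do not form a finite type. *)
Lemma size_image_fibres (T : finType) (U : eqType) (A : {set T}) (f : T -> U)
    (B : seq U) m : uniq B ->
    (forall u, u \in B <-> exists2 x, x \in A & u = f x) ->
    (forall x, x \in A -> #|[set z in A | f z == f x]%SET| = m) ->
  (size B * m)%N = #|A|.
Proof.
move=> uB BP fib; transitivity (\sum_(u <- B) #|[set z in A | f z == u]%SET|)%N.
  rewrite -sum1_size big_distrl /=; apply: eq_big_seq => u /BP[x xA ->].
  by rewrite mul1n fib.
under eq_bigr do rewrite -sum1dep_card big_mkcondr.
rewrite exchange_big /= -sum1_card; apply: eq_bigr => x xA.
rewrite -big_mkcond /= sum1_count (eq_count (a2 := pred1 (f x))).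
  by rewrite count_uniq_mem//; have -> : f x \in B by apply/BP; exists x.
by move=> u; rewrite /= eq_sym.
Qed.

Section Tuples.
Variables (R : realType) (k y n N : nat) (H : R).
Hypotheses (k0 : (0 < k)%N) (HN : N%:R <= H < N.+1%:R).

Notation tuples := {ffun 'I_n -> 'I_N}.

(* [x : tuples] encodes the integers [x i + 1] of the interval [1, N]. *)
Let val1 (x : tuples) (i : 'I_n) : nat := (x i).+1.
Let fld (x : tuples) : set R := radical_field k (val1 x).

Definition good_tuples : {set tuples} := [set x | `[< good k y (val1 x) >]]%SET.
Definition kfree_tuples : {set tuples} :=
  [set x : tuples | [forall i, kfree k (x i).+1]]%SET.
Definition bad_tuples : {set tuples} := (kfree_tuples :\: good_tuples)%SET.

(** The fibre is the orbit of [x] under permutations of the indices, and the action is free because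
    the entries of a good tuple are distinct. *)
Lemma card_good_fibre x : x \in good_tuples ->
  #|[set z in good_tuples | fld z == fld x]%SET| = n`!.
Proof.
rewrite inE => /asboolP gx.
pose act (s : {perm 'I_n}) : tuples := [ffun i => x (s i)].
have actE s : val1 (act s) = val1 x \o s.
  by apply/funext => i; rewrite /val1 ffunE.
rewrite -[RHS]card_Sn -(card_imset _ (f := act)); last first.
  move=> s t /ffunP st; apply/permP => i; apply: (good_inj gx).
  by have := st i; rewrite !ffunE /val1 => ->.
apply: eq_card => z; rewrite !inE; apply/andP/imsetP => [[/asboolP gz /eqP zx]|[s _ ->]].
  have [s sP] := good_same_field k0 gx gz zx; exists s => //.
  by apply/ffunP => i; have [/val_inj zi] := sP i; rewrite zi ffunE.
split; first by apply/asboolP; rewrite actE; exact: good_perm.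
by rewrite /fld actE radical_field_perm.
Qed.

Lemma card_kfree_tuples : #|kfree_tuples| = (kfree_count k N ^ n)%N.
Proof.
have -> : kfree_count k N = #|[pred z : 'I_N | kfree k z.+1]|.
  rewrite /kfree_count big_mkord -sum1_card [RHS]big_mkcond /=.
  by apply: eq_bigr => i _; rewrite inE; case: kfree.
rewrite -[X in (_ ^ X)%N]card_ord -card_ffun_on; apply: eq_card => x; rewrite !inE.
exact/forallP/ffun_onP.
Qed.

Lemma good_sub_kfree : (good_tuples \subset kfree_tuples)%SET.
Proof.
apply/fintype.subsetP => x; rewrite finset.in_set => /asboolP[xk _ _ _].
by rewrite finset.in_set; apply/forallP => i; exact: xk.
Qed.

Lemma card_good_bad : (#|good_tuples| + #|bad_tuples|)%N = (kfree_count k N ^ n)%N.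
Proof.
rewrite -card_kfree_tuples -(cardsID good_tuples kfree_tuples).
by rewrite (finset.setIidPr good_sub_kfree).
Qed.

(** Fields of good tuples are all counted, and each arises from exactly [n!] good tuples.
    Conversely, a counted field is generated by the tuple of [k]-free parts, and bad tuples yield at
    most one field each. *)
Lemma Gcount_bounds :
  (#|good_tuples| <= Gcount k n H * n`! <= #|good_tuples| + #|bad_tuples| * n`!)%N.
Proof.
pose im (A : {set tuples}) : set (set R) := fld @` [set` A].
have imfin A : finite_set (im A) by exact/finite_image/finite_finset.
have goodE : (#|` fset_set (im good_tuples)| * n`!)%N = #|good_tuples|.
  apply: (@size_image_fibres _ _ _ fld); [exact: fset_uniq| |exact: card_good_fibre].
  move=> u; rewrite -[_ \in _]/(u \in fset_set _) in_fset_set// inE.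
  by split=> [[x xA <-]|[x xA ->]]; exists x.
have [NH HN1] := andP HN.
apply/andP; split.
  rewrite -goodE leq_mul2r; apply/orP; right; apply: fsubset_leq_card.
  rewrite -fset_set_sub//; last exact: finite_radical_fields.
  move=> _ [x /= + <-]; rewrite inE => /asboolP gx; exists (val1 x); split=> //.
    by move=> i; split=> //; apply: le_trans NH; rewrite ler_nat ltn_ord.
  exact: good_degree gx.
rewrite -goodE -mulnDl leq_mul2r; apply/orP; right.
apply: (@leq_trans #|` fset_set (im good_tuples `|` im bad_tuples)|).
  apply: fsubset_leq_card; rewrite -fset_set_sub//; last 2 first.
  - exact: finite_radical_fields.
  - by rewrite finite_setU.
  move=> K [a [aH _ ->]].
  have a0 i : (0 < a i)%N by have [] := aH i.
  have aN i : (a i <= N)%N.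
    by rewrite -ltnS -(ltr_nat R); apply: le_lt_trans HN1; have [] := aH i.
  have /choice[df dfP] i : exists df : nat * nat,
      [/\ (0 < df.1)%N, kfree k df.2 & a i = df.1 ^ k * df.2]%N.
    by have [d [f [d0 fk af]]] := kfree_decomp k0 (a0 i); exists (d, f).
  have f0 i : (0 < (df i).2)%N by have [_ /andP[]] := dfP i.
  have fN i : ((df i).2.-1 < N)%N.
    rewrite prednK//; apply: leq_trans (aN i); have [d0 _ ->] := dfP i.
    by rewrite leq_pmull// expn_gt0 d0.
  pose x : tuples := [ffun i => Ordinal (fN i)].
  have xE : val1 x = fun i => (df i).2.
    by apply/funext => i; rewrite /val1 ffunE /= prednK.
  have xK : radical_field k a = fld x.
    rewrite /fld xE; apply: (@radical_field_powfree R k n a (fun i => (df i).1)) => // i.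
      by have [] := dfP i.
    by have [] := dfP i.
  have xkf : x \in kfree_tuples.
    by rewrite inE; apply/forallP => i; have [_ +] := dfP i; rewrite ffunE /= prednK.
  have [gx|bx] := boolP (x \in good_tuples); [left | right]; exists x => //=.
  by rewrite /bad_tuples finset.in_setD bx.
rewrite fset_setU// cardfsU; apply: leq_trans (leq_subr _ _) _; rewrite leq_add2l.
rewrite cardE -(size_map fld); apply: uniq_leq_size => [|u]; first exact: fset_uniq.
rewrite -[_ \in _]/(u \in fset_set _) in_fset_set// inE => -[x xA <-].
by apply: map_f; rewrite mem_enum.
Qed.
End Tuples.

(** * The density of bad tuples *)

Lemma card_box n N (P : 'I_n -> pred 'I_N) :
  #|[set x : {ffun 'I_n -> 'I_N} | [forall i, P i (x i)]]%SET| = (\prod_i #|P i|)%N.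
Proof.
transitivity #|family P|; last by rewrite card_family foldrE big_map big_enum.
by apply: eq_card => x; rewrite finset.in_set; apply/forallP/familyP.
Qed.

(** The factor [N] on the left avoids the exponent [n - 1]; [N ^ 2] does the same in
    [card_slab2]. *)
Lemma card_slab n N (Q : pred 'I_N) (i : 'I_n) :
  (#|[set x : {ffun 'I_n -> 'I_N} | Q (x i)]%SET| * N = #|Q| * N ^ n)%N.
Proof.
have NnE : (N ^ n = N * \prod_(j < n | j != i) N)%N.
  transitivity (\prod_(j < n) N)%N; last by rewrite (bigD1 i).
  by rewrite prod_nat_const card_ord.
rewrite NnE mulnCA [RHS]mulnC; congr (_ * _)%N.
pose P j : pred 'I_N := if j == i then Q else predT.
rewrite (_ : finset _ = [set x : {ffun 'I_n -> 'I_N} | [forall j, P j (x j)]]%SET).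
  rewrite card_box (bigD1 i)//= /P eqxx; congr (_ * _)%N.
  by apply: eq_bigr => j /negPf ->; rewrite cardT size_enum_ord.
apply/setP => x; rewrite !finset.in_set; apply/idP/forallP => [Qx j|/(_ i)].
  by rewrite /P; case: eqP => [->|].
by rewrite /P eqxx.
Qed.

Lemma card_slab2 n N (Q : pred 'I_N) (i j : 'I_n) : i != j ->
  (#|[set x : {ffun 'I_n -> 'I_N} | Q (x i) && Q (x j)]%SET| * N ^ 2 =
   #|Q| ^ 2 * N ^ n)%N.
Proof.
move=> ij; have ji : j != i by rewrite eq_sym.
set X := (\prod_(l < n | (l != i) && (l != j)) N)%N.
have NnE : (N ^ n = N ^ 2 * X)%N.
  transitivity (\prod_(l < n) N)%N; first by rewrite prod_nat_const card_ord.
  by rewrite (bigD1 i)//= (bigD1 j)//= mulnA.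
rewrite NnE mulnCA [RHS]mulnC; congr (_ * _)%N.
pose P l : pred 'I_N := if (l == i) || (l == j) then Q else predT.
rewrite (_ : finset _ = [set x : {ffun 'I_n -> 'I_N} | [forall l, P l (x l)]]%SET).
  rewrite card_box (bigD1 i)//= (bigD1 j)//= /P !eqxx orbT mulnA; congr (_ * _)%N.
  by apply: eq_bigr => l /andP[/negPf -> /negPf ->]; rewrite cardT size_enum_ord.
apply/setP => x; rewrite !finset.in_set; apply/andP/forallP => [[Qi Qj] l|H].
  by rewrite /P; case: eqP => [->//|_]; case: eqP => [->|].
by have := H i; have := H j; rewrite /P !eqxx orbT.
Qed.

Lemma card_multiples N D : (0 < D)%N ->
  #|[pred z : 'I_N | (D %| z.+1)%N]| = (N %/ D)%N.
Proof.
move=> D0; rewrite -sum1_card; have := @big_multiples _ _ addn D N (fun=> 1%N) D0.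
by rewrite sum_nat_const_nat subn0 muln1 big_mkord.
Qed.

Lemma card_bigcup_le (I T : finType) (P : pred I) (F : I -> {set T}) :
  (#|\bigcup_(i | P i) F i| <= \sum_(i | P i) #|F i|)%N.
Proof.
elim/big_rec2: _ => [|i m A _ IH]; first by rewrite cards0.
by apply: leq_trans (leq_card_setU _ _) _; rewrite leq_add2l.
Qed.

Section Bad.
Variables (k y n N : nat).
Hypotheses (y0 : (0 < y)%N) (N0 : (0 < N)%N).

Notation tuples := {ffun 'I_n -> 'I_N}.

Let slab (D : nat) i : {set tuples} := [set x : tuples | (D %| (x i).+1)%N]%SET.
Let slab2 (D : nat) i j : {set tuples} :=
  [set x : tuples | ((D %| (x i).+1) && (D %| (x j).+1))%N]%SET.
Let smth i : {set tuples} := [set x : tuples | smooth y (x i).+1]%SET.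

(** The unions stand for a smooth entry, an entry divisible by the square of a large prime, and a
    large prime shared by two entries. All integers [d.+1 > y] replace the primes, as their inverse
    squares already sum to at most [1 / y]. *)
Lemma bad_tuples_cover : (bad_tuples k y n N \subset
  (\bigcup_i smth i) :|:
  ((\bigcup_i \bigcup_(d < N | (y <= d)%N) slab (d.+1 ^ 2) i) :|:
   (\bigcup_i \bigcup_(j | i != j) \bigcup_(d < N | (y <= d)%N) slab2 d.+1 i j)))%SET.
Proof.
apply/fintype.subsetP => x; rewrite finset.in_setD => /andP[nx xkf].
have /forallP xk : [forall i, kfree k (x i).+1] by move: xkf; rewrite finset.in_set.
have pN (p : nat) (i : 'I_n) : prime p -> (p %| (x i).+1)%N -> (p.-1 < N)%N.
  move=> pp px; rewrite prednK ?prime_gt0//.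
  exact: leq_trans (dvdn_leq (ltn0Sn _) px) (ltn_ord _).
apply: contraNT nx; rewrite !finset.in_setU !negb_or => /and3P[nA nB nC].
rewrite finset.in_set; apply/asboolP; split=> [//|i|i p pp yp|i j p pp yp pi pj].
- by apply: contra nA => sx; apply/bigcupP; exists i => //; rewrite finset.in_set.
- rewrite leqNgt -pfactor_dvdn//; apply: contra nB => px.
  have pi : (p %| (x i).+1)%N by apply: dvdn_trans px; rewrite expnS dvdn_mulr.
  apply/bigcupP; exists i => //; apply/bigcupP; exists (Ordinal (pN _ _ pp pi)).
    by rewrite /= -ltnS prednK ?prime_gt0.
  by rewrite finset.in_set /= prednK ?prime_gt0.
- apply/eqP; apply: contraNT nC => ij.
  apply/bigcupP; exists i => //; apply/bigcupP; exists j => //.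
  apply/bigcupP; exists (Ordinal (pN _ _ pp pi)).
    by rewrite /= -ltnS prednK ?prime_gt0.
  by rewrite finset.in_set /= prednK ?prime_gt0// pi pj.
Qed.

Lemma card_bad_tuples_le (R : realType) : #|bad_tuples k y n N|%:R <=
  (n%:R * ((smooth_count N y)%:R / N%:R) + (n + n ^ 2)%:R / y%:R) * N%:R ^+ n :> R.
Proof.
have NR : 0 < N%:R :> R by rewrite ltr0n.
have Nn0 : 0 <= N%:R ^+ n :> R by rewrite exprn_ge0// ltW.
have cardA i : #|smth i|%:R = (smooth_count N y)%:R / N%:R * N%:R ^+ n :> R.
  apply: (mulIf (lt0r_neq0 NR)); rewrite mulrAC divfK ?gt_eqF// -natrX -!natrM.
  rewrite /smth (card_slab (fun z => smooth y z.+1)); congr (_ * _)%:R.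
  rewrite /smooth_count big_mkord -sum1_card [LHS]big_mkcond.
  by apply: eq_bigr => z _; rewrite unfold_in; case: smooth.
have dD (D m : nat) : (0 < D)%N -> (m = N %/ D)%N -> m%:R <= N%:R / D%:R :> R.
  by move=> D0 ->; rewrite ler_pdivlMr ?ltr0n// -natrM ler_nat leq_trunc_div.
have cardB i (d : 'I_N) :
    #|slab (d.+1 ^ 2) i|%:R <= (d.+1%:R ^+ 2)^-1 * N%:R ^+ n :> R.
  rewrite -(ler_pM2r NR) -natrM (card_slab (fun z => d.+1 ^ 2 %| z.+1)%N).
  rewrite natrM natrX mulrAC ler_wpM2r// mulrC -natrX.
  by apply: dD; rewrite ?expn_gt0// card_multiples ?expn_gt0.
have cardC i j (d : 'I_N) : i != j ->
    #|slab2 d.+1 i j|%:R <= (d.+1%:R ^+ 2)^-1 * N%:R ^+ n :> R.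
  move=> ij; rewrite -(ler_pM2r (exprn_gt0 2 NR)) -[N%:R ^+ 2]natrX -natrM.
  rewrite (card_slab2 (fun z => d.+1 %| z.+1)%N ij) natrM !natrX.
  rewrite [leRHS]mulrAC ler_wpM2r//.
  rewrite mulrC -expr_div_n lerXn2r ?nnegrE ?divr_ge0//.
  by apply: dD => //; rewrite card_multiples.
have sumd : \sum_(d < N | (y <= d)%N) (d.+1%:R ^+ 2)^-1 * N%:R ^+ n <=
    y%:R^-1 * N%:R ^+ n :> R.
  rewrite -mulr_suml ler_wpM2r//; apply: le_trans (sum_inv_sqr_le R N y0).
  rewrite big_mkcond -(big_mkord xpredT
    (fun d => if (y <= d)%N then (d.+1%:R ^+ 2)^-1 else 0)).
  have [Ny|yN] := leqP N y.
    rewrite [leRHS]big_geq// big_nat big1// => d /andP[_ dN].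
    by rewrite leqNgt (leq_trans dN Ny).
  rewrite (@big_cat_nat _ _ _ y)//= 1?ltnW// big_nat big1 ?add0r.
    by rewrite !big_nat; apply: ler_sum => d /andP[-> _].
  by move=> d /andP[_ dy]; rewrite leqNgt dy.
apply: (@le_trans _ _ (\sum_(i < n) #|smth i|%:R +
   (\sum_(i < n) \sum_(d < N | (y <= d)%N) #|slab (d.+1 ^ 2) i|%:R +
    \sum_(i < n) \sum_(j | i != j) \sum_(d < N | (y <= d)%N) #|slab2 d.+1 i j|%:R))).
  under [X in _ + (X + _)]eq_bigr do rewrite -natr_sum.
  under [X in _ + (_ + X)]eq_bigr => i _.
    under eq_bigr do rewrite -natr_sum.
    rewrite -natr_sum; over.
  rewrite -!natr_sum -!natrD ler_nat.
  apply: leq_trans (subset_leq_card bad_tuples_cover) _.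
  apply: leq_trans (leq_card_setU _ _) _; apply: leq_add; first exact: card_bigcup_le.
  apply: leq_trans (leq_card_setU _ _) _; apply: leq_add.
    apply: leq_trans (card_bigcup_le _ _) _; apply: leq_sum => i _.
    exact: card_bigcup_le.
  apply: leq_trans (card_bigcup_le _ _) _; apply: leq_sum => i _.
  apply: leq_trans (card_bigcup_le _ _) _; apply: leq_sum => j _.
  exact: card_bigcup_le.
have const_sum (c : R) : \sum_(i < n) c = n%:R * c.
  by rewrite sumr_const card_ord mulr_natl.
have yN0 : 0 <= y%:R^-1 * N%:R ^+ n :> R by rewrite mulr_ge0// invr_ge0.
rewrite mulrDl natrD natrX mulrDl mulrDl; apply: lerD.
  by under eq_bigr do rewrite cardA; rewrite const_sum -[leRHS]mulrA.
apply: lerD.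
  rewrite -mulrA -const_sum; apply: ler_sum => i _; apply: le_trans sumd.
  by apply: ler_sum => d _; exact: cardB.
rewrite expr2 -!mulrA -2!const_sum; apply: ler_sum => i _.
apply: (@le_trans _ _ (\sum_(j < n | i != j) y%:R^-1 * N%:R ^+ n)).
  apply: ler_sum => j ij; apply: le_trans sumd.
  by apply: ler_sum => d _; exact: cardC.
by rewrite big_mkcond; apply: ler_sum => j _; case: ifP.
Qed.
End Bad.

(** * Choice of the smoothness bound *)

(** This is the mean value bound [n M^(n-1) |a - b|], multiplied by [M] to avoid the exponent
    [n - 1]. *)
Lemma norm_expnB_le (R : realDomainType) (a b M : R) n : `|a| <= M -> `|b| <= M ->
  `|a ^+ n - b ^+ n| * M <= n%:R * M ^+ n * `|a - b|.
Proof.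
move=> aM bM; have M0 : 0 <= M := le_trans (normr_ge0 _) aM.
elim: n => [|n IH]; first by rewrite subrr normr0 !mul0r.
have -> : a ^+ n.+1 - b ^+ n.+1 = a * (a ^+ n - b ^+ n) + b ^+ n * (a - b).
  by rewrite !exprS; ring.
apply: (@le_trans _ _ ((M * `|a ^+ n - b ^+ n| + M ^+ n * `|a - b|) * M)).
  rewrite ler_wpM2r//; apply: le_trans (ler_normD _ _) _; rewrite !normrM normrX.
  by apply: lerD; rewrite ler_wpM2r// lerXn2r.
have -> : n.+1%:R * M ^+ n.+1 * `|a - b| =
    M * (n%:R * M ^+ n * `|a - b|) + M ^+ n * `|a - b| * M.
  by rewrite -natr1 exprS; ring.
by rewrite mulrDl lerD2r -mulrA ler_wpM2l.
Qed.

(** From 9 on, the quadratic term [t^2 / 2] suffices. The constant is the one that gives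
    [Z <= expR t / 3] in [cutoff_bounds]. *)
Lemma linear_le_expR (R : realType) (t : R) : 9 <= t -> 9 / 2 * t <= expR t.
Proof.
move=> t9; have t0 : 0 <= t by lra.
by have := expR_ge1Dxn 1 t0; rewrite (_ : 2`! = 2)//; nra.
Qed.

(** For [t = log log H], [expR t] is [log H] and [Z] is the square root in the final exponent; the
    relative loss in that exponent will be of order [1 / w]. *)
Lemma cutoff_bounds (R : realType) (t w Z : R) : 9 <= t ->
    w = Num.sqrt t -> Z = Num.sqrt (expR t * t / 2) ->
  [/\ w ^+ 2 = t, 3 <= w, Z ^+ 2 = expR t * t / 2, t <= Z <= expR t / 3 &
      w * expR (t / 2) <= 2 * Z].
Proof.
move=> t9 wE ZE; have tl := linear_le_expR t9.
have w2 : w ^+ 2 = t by rewrite wE sqr_sqrtr//; lra.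
have w0 : 0 <= w by rewrite wE sqrtr_ge0.
have l0 := expR_gt0 t.
have Z2 : Z ^+ 2 = expR t * t / 2 by rewrite ZE sqr_sqrtr//; nra.
have Z0 : 0 <= Z by rewrite ZE sqrtr_ge0.
have h2 : expR (t / 2) ^+ 2 = expR t.
  by rewrite -expRM_natr; congr expR; lra.
have h0 := expR_gt0 (t / 2).
split=> //.
- by rewrite -(@ler_pXn2r _ 2)// ?nnegrE// w2; lra.
- have t0 : 0 <= t by lra.
  have l30 : 0 <= expR t / 3 by lra.
  by apply/andP; split; rewrite -(@ler_pXn2r _ 2)// ?nnegrE// Z2; nra.
- have wh : 0 <= w * expR (t / 2) by rewrite mulr_ge0// ltW.
  have ZZ : 0 <= 2 * Z by rewrite mulr_ge0.
  by rewrite -(@ler_pXn2r _ 2)// ?nnegrE// !exprMn Z2 w2 h2; nra.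
Qed.

(** The witness [y] is a power of two, as in [sum_inv_primes_le], with [expR Z < y <= 2 expR Z].
    Rankin's bound with exponent [1 - d] then weighs the saving [N^(- d)] against the cost of the
    primes up to [y]. *)
Lemma smooth_density_le (R : realType) (t w Z H : R) (N : nat) : 9 <= t ->
    w = Num.sqrt t -> Z = Num.sqrt (expR t * t / 2) -> H = expR (expR t) ->
    N%:R <= H < N.+1%:R ->
  exists y : nat, [/\ (0 < y)%N, y%:R^-1 <= expR (- Z) &
    (smooth_count N y)%:R / N%:R <= 2 * expR (- (1 - 98 / w) * Z)].
Proof.
move=> t9 wE ZE lH /andP[NH HN].
have [w2 w3 Z2 /andP[tZ Zl] half] := cutoff_bounds t9 wE ZE.
have lt92 := linear_le_expR t9.
move lt : (expR t) lH Z2 Zl lt92 => l lH Z2 Zl lt92.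
have l0 : 0 < l by rewrite -lt expR_gt0.
have H0 : 0 < H by rewrite lH expR_gt0.
have ln2_gt : 2^-1 <= ln 2 :> R.
  by have := @le_ln1Dx R (- 2^-1); rewrite (_ : 1 + - 2^-1 = 2^-1) ?lnV ?posrE//; lra.
have ln2_le : ln 2 <= 1 :> R.
  by have := @le_ln1Dx R 1; rewrite (_ : 1 + 1 = 2)//; apply; lra.
have w0 : 0 < w by lra.
pose J := Num.truncn (Z / ln 2).
have Zln0 : 0 <= Z / ln 2 by rewrite divr_ge0//; lra.
have /andP[JZ ZJ] : J%:R <= Z / ln 2 < J.+1%:R by exact: truncn_itv.
have ln20 : 0 < ln 2 :> R by lra.
rewrite ler_pdivlMr// in JZ; rewrite ltr_pdivrMr// in ZJ.
pose y := (2 ^ J.+1)%N.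
have yE : y%:R = expR (J.+1%:R * ln 2) :> R by rewrite expRM_natl lnK ?posrE// natrX.
have Z0 : 0 < Z by lra.
have J0 : (0 < J)%N.
  by rewrite lt0n; apply/eqP => J0; rewrite J0 in ZJ; lra.
exists y; split; first by rewrite expn_gt0.
  by rewrite yE -expRN ler_expR; lra.
(* [d = t / (2 Z)] would make [l d = Z] but [y^d S] slightly larger than [Z]. *)
pose d := (t / 2 - w) / Z.
have dZ : d * Z = t / 2 - w by rewrite divfK// gt_eqF.
have d0 : 0 <= d by rewrite divr_ge0//; nra.
have d12 : d <= 2^-1.
  rewrite ler_pdivrMr//; nra.
have N0 : (0 < N)%N.
  rewrite lt0n; apply/eqP => N0; rewrite N0 in HN.
  have := expR_ge1Dx l; rewrite -lH; lra.
have NR : 0 < N%:R :> R by rewrite ltr0n.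
have NH2 : H <= 2 * N%:R.
  have N1 : 1 <= N%:R :> R by rewrite ler1n.
  by move: HN; rewrite -natr1; lra.
have s12 : 2^-1 <= 1 - d <= 1 by apply/andP; split; lra.
have := rankin_bound N y s12; rewrite (_ : 1 - (1 - d) = d); last by lra.
set S := \sum_(0 <= m < y | _) _ => Psi.
(* [3 + 2 ln J <= 3 + 2 t <= 3 t], since [J <= 2 Z <= expR t]. *)
have St : S <= 3 * t.
  apply: le_trans (sum_inv_primes_le R J0) _.
  have : ln J%:R <= t.
    rewrite -[t]expRK lt ler_ln ?posrE ?ltr0n//.
    have JR : 0 <= J%:R :> R by [].
    nra.
  by lra.
have S0 : 0 <= S by apply: sumr_ge0 => m _; rewrite invr_ge0.
have ld : l * d = Z - 2 * Z / w.
  have lE : l = 2 * Z ^+ 2 / w ^+ 2 by rewrite w2 Z2; field; lra.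
  by rewrite /d lE -w2; field; rewrite !gt_eqF.
have yd : y%:R `^ d <= expR (t / 2 - w + 2^-1).
  rewrite yE -expRM ler_expR -dZ -natr1.
  have : d * (J%:R * ln 2) <= d * Z by exact: ler_wpM2l.
  have : d * ln 2 <= 2^-1 by nra.
  by lra.
(* The term [- w] in [d] pays for the factor [t = w^2] coming from [S], as [w^2 expR (- w) <= 2].
   The constants give [4 * 3 * 2 * 2 = 48] times [expR (t / 2) <= 2 Z / w]. *)
have ydS : 4 * (y%:R `^ d * S) <= 96 * Z / w.
  have e12 : expR 2^-1 <= 2 :> R.
    have := @expR_ge1Dx R (- 2^-1); rewrite expRN (_ : 1 + - 2^-1 = 2^-1); last by lra.
    by rewrite lef_pV2 ?posrE ?expR_gt0.
  have ww : w ^+ 2 * expR (- w) <= 2.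
    rewrite expRN ler_pdivrMr ?expR_gt0//.
    have := expR_ge1Dxn 1 (ltW w0); rewrite (_ : 2`! = 2)//; lra.
  have E0 := expR_gt0 (t / 2 - w + 2^-1).
  apply: (@le_trans _ _ (4 * (expR (t / 2 - w + 2^-1) * (3 * t)))).
    by rewrite ler_pM2l// ler_pM// powR_ge0.
  have -> : expR (t / 2 - w + 2^-1) * (3 * t) =
      3 * (w ^+ 2 * expR (- w)) * expR 2^-1 * expR (t / 2).
    by rewrite !expRD w2; ring.
  have h0 := expR_gt0 (t / 2).
  have : 4 * (3 * (w ^+ 2 * expR (- w)) * expR 2^-1 * expR (t / 2)) <= 48 * expR (t / 2).
    rewrite !mulrA ler_pM2r// -!mulrA.
    have wp : 0 <= w ^+ 2 * expR (- w) by rewrite mulr_ge0 ?expR_ge0// exprn_ge0// ltW.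
    have := @expR_gt0 R 2^-1; nra.
  move=> /le_trans; apply; rewrite ler_pdivlMr//; lra.
have HdE : H `^ d = expR (l * d) by rewrite lH expRM.
(* [N >= H / 2] and [0 <= d <= 1], so that [N^(- d) <= 2 H^(- d)]. *)
have Nd : N%:R `^ (- d) <= 2 * expR (- (l * d)).
  rewrite powRN expRN -HdE -(invrK 2) -invfM lef_pV2 ?posrE ?mulr_gt0 ?powR_gt0//.
  rewrite ler_pdivrMl//.
  apply: (@le_trans _ _ ((2 * N%:R) `^ d)).
    by apply: ge0_ler_powR; rewrite ?nnegrE// ?mulr_ge0// ltW.
  rewrite powRM// ler_wpM2r ?powR_ge0// -[leRHS]powRr1//.
  by apply: ler_powR; lra.
rewrite ler_pdivrMr//; apply: le_trans Psi _.
rewrite powRD; last by apply/implyP => _; rewrite gt_eqF.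
rewrite powRr1// -mulrA [leLHS]mulrC ler_pM2r//.
apply: (@le_trans _ _ (2 * expR (- (l * d)) * expR (96 * Z / w))).
  by apply: ler_pM; rewrite ?powR_ge0 ?expR_ge0// ler_expR.
(* The loss [98 / w] collects [2 / w] from [l * d] and [96 / w] from the primes. *)
rewrite -mulrA -expRD ler_pM2l// ler_expR ld.
by rewrite [leLHS](_ : _ = - (1 - 98 / w) * Z)//; field; rewrite gt_eqF.
Qed.

(** * The error term *)

(** [G * n!] differs from the number [F ^ n] of [k]-free tuples by at most [n!] times the number of
    bad ones, and [F] differs from [H / zeta k] by [O(H^(2/3))], a relative error of order
    [H^(-1/3)]. *)
Lemma Gcount_density (R : realType) (k n y N : nat) (H : R) :
    (3 <= k)%N -> (0 < y)%N -> (0 < N)%N -> N%:R <= H < N.+1%:R ->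
  `|(Gcount k n H)%:R / H ^+ n - (n`!%:R * zeta k%:R ^+ n)^-1| <=
   n%:R * ((smooth_count N y)%:R / N%:R) + (n + n ^ 2)%:R / y%:R +
   8 * n%:R * H `^ (- 3^-1).
Proof.
move=> k3 y0 N0 NH; have k0 : (0 < k)%N by lia.
have [NH1 NH2] := andP NH.
have N1 : 1 <= N%:R :> R by rewrite ler1n.
have H0 : 0 < H by lra.
have z1 : 1 <= zeta k%:R :> R by apply: zeta_ge1; lia.
set z := zeta _ in z1 *; have z0 : 0 < z by lra.
have := Gcount_bounds y n k0 NH; have := card_good_bad k y n N.
have := card_bad_tuples_le k n y0 N0 R.
set A := #|good_tuples _ _ _ _|; set B := #|bad_tuples _ _ _ _|.
set G := Gcount k n H; set F := kfree_count k N; set P := _ + _ / y%:R => Bbd AB.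
move=> /andP[AG GA].
have P0 : 0 <= P.
  by rewrite addr_ge0 ?mulr_ge0 ?divr_ge0 ?invr_ge0.
have Hn0 : 0 < H ^+ n by exact: exprn_gt0.
have f1 : 1 <= n`!%:R :> R by rewrite ler1n fact_gt0.
have f0 : 0 < n`!%:R :> R by lra.
have BH : B%:R <= P * H ^+ n.
  apply: le_trans Bbd _; rewrite ler_wpM2l// lerXn2r ?nnegrE//; exact: ltW.
have Fz : `|F%:R - H / z| <= 8 * H `^ (2 / 3) by exact: kfree_count_asymptotic NH.
have FH : F%:R <= H.
  apply: le_trans NH1; rewrite ler_nat /F /kfree_count.
  apply: leq_trans (_ : \sum_(0 <= m < N) 1 <= N)%N; last first.
    by rewrite sum_nat_const_nat subn0 muln1.
  by apply: leq_sum => m _; exact: leq_b1.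
have FnH : `|F%:R ^+ n - (H / z) ^+ n| <= 8 * n%:R * H `^ (- 3^-1) * H ^+ n.
  have nF : `|F%:R| <= H by rewrite ger0_norm.
  have nHz : `|H / z| <= H.
    by rewrite ger0_norm ?divr_ge0 ?(ltW H0) ?(ltW z0)// ler_pdivrMr// ler_peMr ?(ltW H0).
  have le1 := norm_expnB_le n nF nHz.
  rewrite -(ler_pM2r H0); apply: le_trans le1 _.
  have -> : 8 * n%:R * H `^ (- 3^-1) * H ^+ n * H =
     n%:R * H ^+ n * (8 * (H `^ (- 3^-1) * H)) by ring.
  rewrite ler_wpM2l ?mulr_ge0 ?(ltW Hn0)//; apply: le_trans Fz _; rewrite ler_pM2l//.
  rewrite -{3}(powRr1 (ltW H0)) -powRD; last by apply/implyP => _; rewrite gt_eqF.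
  by rewrite (_ : - 3^-1 + 1 = 2 / 3)//; lra.
have nG : `|G%:R * n`!%:R - F%:R ^+ n| <= B%:R * n`!%:R :> R.
  rewrite -natrX -AB natrD ler_norml.
  move: AG GA; rewrite -!(ler_nat R) natrD !natrM => AG GA.
  have B0 : 0 <= B%:R :> R by [].
  by apply/andP; split; nra.
rewrite -(ler_pM2r Hn0) -(ler_pM2r f0) -[X in _ * X * _ <= _](gtr0_norm Hn0).
rewrite -[X in _ * X <= _](gtr0_norm f0) -!normrM.
have -> : (G%:R / H ^+ n - (n`!%:R * z ^+ n)^-1) * H ^+ n * n`!%:R =
  (G%:R * n`!%:R - F%:R ^+ n) + (F%:R ^+ n - (H / z) ^+ n).
  by rewrite expr_div_n; field; rewrite !gt_eqF ?exprn_gt0.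
apply: le_trans (ler_normD _ _) _; apply: le_trans (lerD nG FnH) _.
set Q := 8 * n%:R * _; have Q0 : 0 <= Q * H ^+ n.
  by rewrite mulr_ge0 ?(ltW Hn0)// mulr_ge0 ?powR_ge0// mulr_ge0.
rewrite mulrDl mulrDl; apply: lerD; first by rewrite ler_pM2r.
by rewrite ler_peMr.
Qed.

Lemma lnln_ge (R : realType) (c H : R) : expR (expR c) <= H -> c <= ln (ln H).
Proof.
move=> cH; have l : expR c <= ln H.
  by rewrite -ler_expR lnK// posrE; apply: lt_le_trans cH; exact: expR_gt0.
by rewrite -ler_expR lnK// posrE; apply: lt_le_trans l; exact: expR_gt0.
Qed.

Theorem theorem3p4 (R : realType) (k n : nat)
    (k_ge3 : (3 <= k)%N) (k_odd : odd k) (n_ge1 : (1 <= n)%N) :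
  exists eps E : R -> R,
    [/\ eps H @[H --> +oo] --> 0,
        exists C : R, \forall H \near +oo,
          `|E H| <=
            C * expR (- (1 + eps H) * Num.sqrt (ln H * ln (ln H) / 2))
      & \forall H \near +oo,
          (Gcount k n H)%:R
            = ((n`!%:R * zeta k%:R ^+ n)^-1 + E H) * H ^+ n].
Proof.
(* [eps] is the loss found in [smooth_density_le], and [E] is the exact error, so that the last
   claim is an identity. *)
exists (fun H => - (98 / Num.sqrt (ln (ln H)))).
exists (fun H => (Gcount k n H)%:R / H ^+ n - (n`!%:R * zeta k%:R ^+ n)^-1); split.
- apply/cvgrPdist_le => e e0; near=> H; rewrite sub0r opprK ger0_norm ?divr_ge0 ?sqrtr_ge0//.
  have : (98 / e) ^+ 2 <= ln (ln H) by apply: lnln_ge; near: H; exact: nbhs_pinfty_ge.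
  have e98 : 0 < 98 / e by rewrite divr_gt0.
  have e980 : 0 < (98 / e) ^+ 2 by exact: exprn_gt0.
  move=> tH; have tH0 : 0 < ln (ln H) by exact: lt_le_trans tH.
  rewrite ler_pdivrMr ?sqrtr_gt0// mulrC -ler_pdivrMr//.
  by rewrite -[98 / e]ger0_norm ?(ltW e98)// -sqrtr_sqr ler_sqrt// ltW.
- exists (2 * n%:R + (n + n ^ 2)%:R + 8 * n%:R); near=> H.
  have H9 : expR (expR 9) <= H by near: H; exact: nbhs_pinfty_ge.
  have H0 : 0 < H by apply: lt_le_trans H9; exact: expR_gt0.
  have t9 := lnln_ge H9; set t := ln (ln H) in t9 *.
  have l0 : 0 < ln H.
    by apply: (lt_le_trans (expR_gt0 9)); rewrite -ler_expR lnK.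
  have lt : ln H = expR t by rewrite lnK.
  have HE : H = expR (expR t) by rewrite -lt lnK.
  have [w2 w3 Z2 /andP[tZ Zl] half] := cutoff_bounds t9 erefl erefl.
  rewrite lt; set Z := Num.sqrt (expR t * t / 2) in Z2 tZ Zl half *.
  set w := Num.sqrt t in w2 w3 half *.
  pose N := Num.truncn H.
  have NH : N%:R <= H < N.+1%:R by apply: truncn_itv; exact: ltW.
  have N0 : (0 < N)%N.
    rewrite lt0n; apply/eqP => N0; move: NH; rewrite N0 => /andP[_].
    have := expR_ge1Dx (expR 9 : R); have := expR_gt0 (9 : R); lra.
  have [y [y0 yZ Psi]] := smooth_density_le t9 erefl erefl HE NH.
  rewrite -/w -/Z in yZ Psi; apply: le_trans (Gcount_density n k_ge3 y0 N0 NH) _.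
  (* The smooth term dominates: [1 / y <= expR (- Z)], and [H^(-1/3) <= expR (- Z)] because
     [Z <= ln H / 3]. *)
  have expZ : expR (- Z) <= expR (- (1 - 98 / w) * Z).
    rewrite ler_expR mulNr lerN2 ler_piMl ?gerBl ?divr_ge0//; lra.
  move: (expR (- (1 - 98 / w) * Z)) Psi expZ => X Psi expZ.
  rewrite [leRHS]mulrDl [X in _ <= X + _]mulrDl; apply: lerD; first apply: lerD.
  + by rewrite -[leRHS]mulrA [leRHS]mulrCA ler_wpM2l.
  + by rewrite ler_wpM2l//; exact: le_trans expZ.
  + rewrite ler_wpM2l ?mulr_ge0//; apply: le_trans expZ.
    by rewrite [in leLHS]HE -expRM ler_expR; lra.
- near=> H; have H0 : 0 < H by near: H; exact: nbhs_pinfty_gt.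
  by rewrite addrC subrK divfK// gt_eqF// exprn_gt0.
Unshelve. all: by end_near.
Qed.
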